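(* There is a universal constant $C$ such that the following holds. Let $G$ be a finite group and $H_1,H_2\leq G$. Let $\mathcal{M}$ be the random Fourier sampling POVM on $\mathbb{C}^{|G|}$: apply $\mathrm{QFT}_G$, measure the irrep name $\rho\in\widehat G$ and the row index $i$, and then apply to the resulting reduced state on the column index space $\mathbb{C}^{d_\rho}$ an independent random POVM $\mathcal{M}_\rho$, where $\mathcal{M}_\rho$ is constructed as follows with $K_\rho := \lceil C\log^2|G|/d_\rho\rceil$ and $m_\rho := K_\rho d_\rho$: take independent random vectors $b_1,\ldots,b_{m_\rho}\in\mathbb{C}^{d_\rho}\otimes\mathbb{C}^{K_\rho}$ with independent complex coordinates whose real and imaginary parts are independent standard real Gaussians; set $\ell:=\|\sum_j b_jb_j^\dagger\|$ and $\nu := I - \frac1\ell\sum_j b_jb_j^\dagger$; $\mathcal{M}_\rho$ maps $\tau$ to $\tau\otimes|0\rangle\langle 0|$ and measures with the POVM elements $\frac{b_jb_j^\dagger}{\ell}$ ($1\le j\le m_\rho$) and $\nu$. Then with probability at least $1-\exp(-\log^2|G|)$ over the choice of $\mathcal{M}$, \[ \|\mathcal{M}(\sigma_{H_1})-\mathcal{M}(\sigma_{H_2})\|_1 \geq \Omega(r(H_1,H_2)). \]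
   Context: Let $G$ be a finite group, $\widehat G$ a complete set of inequivalent irreducible unitary representations (irreps) of $G$, $d_\rho$ the dimension of $\rho$, and $\rho^\ast$ the entrywise complex conjugate representation. On $\mathbb{C}^{|G|}$ with basis $\{|g\rangle\}$, the coset state of $H\le G$ is $\sigma_H := \frac{1}{|G|}\sum_{g\in G}|gH\rangle\langle gH|$ with $|gH\rangle := |H|^{-1/2}\sum_{h\in H}|gh\rangle$. The quantum Fourier transform is the unitary $\mathrm{QFT}_G: |g\rangle\mapsto\sum_{\rho\in\widehat G}\sqrt{d_\rho/|G|}\sum_{i,j=1}^{d_\rho}\rho_{ij}(g)|\rho,i,j\rangle$. For $H\le G$, $\rho(H) := \frac{1}{|H|}\sum_{h\in H}\rho(h)$ (an orthogonal projection), $r_\rho(H):=\mathrm{rank}\,\rho(H)$; then $\mathrm{QFT}_G\,\sigma_H\,\mathrm{QFT}_G^\dagger = \frac{|H|}{|G|}\bigoplus_{\rho}\bigoplus_{i=1}^{d_\rho}|\rho,i\rangle\langle\rho,i|\otimes\rho^\ast(H)$, so observing $(\rho,i)$ leaves the state $\rho^\ast(H)/r_\rho(H)$ on the column index space. Define $\mathcal{P}_H(\rho) := d_\rho|H|r_\rho(H)/|G|$, $w(H_1,H_2) := \sum_{\rho\in\widehat G}|\mathcal{P}_{H_1}(\rho)-\mathcal{P}_{H_2}(\rho)|$, and \[ r(H_1,H_2) := w(H_1,H_2) + \frac{1}{|G|\log|G|}\sum_{\rho\in\widehat G} d_\rho\,\big\| |H_1|\rho(H_1)-|H_2|\rho(H_2)\big\|_F,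 \] where $\|A\|_F := \sqrt{\mathrm{Tr}A^\dagger A}$. For a POVM $\mathcal{M}$ with elements $E_k$, $\mathcal{M}(\sigma):=(\mathrm{Tr}(\sigma E_k))_k$, and $\|p-q\|_1:=\sum_k|p_k-q_k|$. $\Omega(\cdot)$ hides a positive universal constant. *)

(* Defs.v *)
From HB Require Import structures.
From mathcomp Require Import all_boot all_order all_algebra all_fingroup.
From mathcomp Require Import mxrepresentation complex.
From mathcomp Require Import all_classical all_reals all_analysis.
From mathcomp Require Import normal_distribution.

Set Implicit Arguments.
Unset Strict Implicit.
Unset Printing Implicit Defensive.

Import Order.TTheory GRing.Theory Num.Theory.
Local Open Scope classical_set_scope.
Local Open Scope ring_scope.

Section Defs.
Variable Rr : realType.
Local Notation Cc := (Rr[i]).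

Definition toC (x : Rr) : Cc := Complex x 0.
Definition cnorm2 (z : Cc) : Rr := complex.Re z ^+ 2 + complex.Im z ^+ 2.
Definition cabs (z : Cc) : Rr := Num.sqrt (cnorm2 z).
Definition ctrmx m n (A : 'M[Cc]_(m, n)) : 'M[Cc]_(n, m) := map_mx (@conjc _) A^T.

Definition vnorm (I : finType) (v : I -> Cc) : Rr := Num.sqrt (\sum_i cnorm2 (v i)).
Definition opnorm (I : finType) (M : I -> I -> Cc) : Rr :=
  sup [set vnorm (fun i => \sum_j M i j * v j) | v in [set v : I -> Cc | vnorm v <= 1]].
Definition frob n (A : 'M[Cc]_n) : Rr := Num.sqrt (\sum_i \sum_j cnorm2 (A i j)).

Record irrep_system (gT : finGroupType) := IrrepSystem {
  nirr : nat;
  irdim : 'I_nirr -> nat;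
  irrep : forall r : 'I_nirr, mx_representation Cc [set: gT]%G (irdim r);
  irrep_irreducible : forall r, mx_irreducible (irrep r);
  irrep_unitary : forall r (x : gT), irrep r x *m ctrmx (irrep r x) = 1%:M;
  irrep_inequiv : forall r s, mx_rsim (irrep r) (irrep s) -> r = s;
  irrep_complete : forall n (rG : mx_representation Cc [set: gT]%G n),
      mx_irreducible rG -> exists r, mx_rsim rG (irrep r)
}.

Section Fourier.
Variables (gT : finGroupType) (S : irrep_system gT).

(* Fourier basis |rho,i,j> *)
Definition fidx_fam (r : 'I_(nirr S)) := ('I_(irdim r) * 'I_(irdim r))%type.
Definition fidx := {r : 'I_(nirr S) & fidx_fam r}.

Definition qft (f : fidx) (g : gT) : Cc :=
  toC (Num.sqrt ((irdim (tag f))%:R / #|gT|%:R)) *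
  @irrep _ S (tag f) g (tagged f).1 (tagged f).2.

(* coset state sigma_H = 1/|G| sum_g |gH><gH| ; |gH><gH|(a,b) = [a,b in gH]/|H| *)
Definition coset_state (H : {group gT}) (a b : gT) : Cc :=
  (\sum_(g : gT) ((a \in lcoset H g) && (b \in lcoset H g))%:R) / (#|gT| * #|H|)%:R.

Definition fstate (H : {group gT}) (f f' : fidx) : Cc :=
  \sum_(a : gT) \sum_(b : gT) qft f a * coset_state H a b * conjc (qft f' b).

Definition rhoH (r : 'I_(nirr S)) (H : {group gT}) : 'M[Cc]_(irdim r) :=
  (#|H|%:R)^-1 *: \sum_(h in H) @irrep _ S r h.

Definition PH (H : {group gT}) (r : 'I_(nirr S)) : Rr :=
  (irdim r * #|H| * \rank (rhoH r H))%:R / #|gT|%:R.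

Definition wdist (H1 H2 : {group gT}) : Rr := \sum_r `|PH H1 r - PH H2 r|.

Definition rdist (H1 H2 : {group gT}) : Rr :=
  wdist H1 H2 + (#|gT|%:R * ln (#|gT|%:R : Rr))^-1 *
    \sum_r (irdim r)%:R * frob (#|H1|%:R *: rhoH r H1 - #|H2|%:R *: rhoH r H2).

Variable Cst : Rr.

Definition Kdim (r : 'I_(nirr S)) : nat :=
  `|Num.ceil (Cst * ln (#|gT|%:R : Rr) ^+ 2 / (irdim r)%:R)|%N.
Definition mdim (r : 'I_(nirr S)) : nat := (Kdim r * irdim r)%N.

(* index of the real Gaussians: (rho, vector index t < m_rho, coordinate (a,k) in
   C^{d_rho} (x) C^{K_rho}, real part (true) / imaginary part (false)) *)
Definition gfam (r : 'I_(nirr S)) :=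
  ('I_(mdim r) * 'I_(irdim r) * 'I_(Kdim r) * bool)%type.
Definition gidx := {r : 'I_(nirr S) & gfam r}.

Section Realization.
Variable x : gidx -> Rr.

Definition bvec (r : 'I_(nirr S)) (t : 'I_(mdim r)) (a : 'I_(irdim r)) (k : 'I_(Kdim r)) : Cc :=
  Complex (x (@Tagged _ r gfam (t, a, k, true))) (x (@Tagged _ r gfam (t, a, k, false))).

Definition bsum (r : 'I_(nirr S)) (u v : ('I_(irdim r) * 'I_(Kdim r))%type) : Cc :=
  \sum_(t : 'I_(mdim r)) bvec t u.1 u.2 * conjc (bvec t v.1 v.2).

Definition ell (r : 'I_(nirr S)) : Rr := opnorm (@bsum r).

Definition povmE (r : 'I_(nirr S)) (o : option 'I_(mdim r))
  (u v : ('I_(irdim r) * 'I_(Kdim r))%type) : Cc :=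
  match o with
  | Some t => bvec t u.1 u.2 * conjc (bvec t v.1 v.2) / toC (ell r)
  | None => (u == v)%:R - @bsum r u v / toC (ell r)
  end.

(* effective operator on C^{d_rho} of tau |-> tau (x) |0><0| followed by povmE:
   entry (a,a') of (I (x) <0|) E (I (x) |0>) *)
Definition povmF (r : 'I_(nirr S)) (o : option 'I_(mdim r)) (a a' : 'I_(irdim r)) : Cc :=
  \sum_(k : 'I_(Kdim r) | val k == 0%N) povmE o (a, k) (a', k).

(* outcomes of the random Fourier sampling POVM: (rho, row index i, outcome of M_rho) *)
Definition outc_fam (r : 'I_(nirr S)) := ('I_(irdim r) * option 'I_(mdim r))%type.
Definition outc := {r : 'I_(nirr S) & outc_fam r}.

(* Tr( QFT sigma QFT^dag . (|rho,i><rho,i| (x) F_o) ) *)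
Definition povm_prob (H : {group gT}) (o : outc) : Cc :=
  \sum_(j : 'I_(irdim (tag o))) \sum_(j' : 'I_(irdim (tag o)))
    fstate H (@Tagged _ (tag o) fidx_fam ((tagged o).1, j))
             (@Tagged _ (tag o) fidx_fam ((tagged o).1, j'))
    * povmF (tagged o).2 j' j.

Definition povm_dist (H1 H2 : {group gT}) : Rr :=
  \sum_(o : outc) cabs (povm_prob H1 o - povm_prob H2 o).

End Realization.
End Fourier.

Definition iid_std_gaussian d (T : measurableType d) (P : probability T Rr)
    (I : finType) (g : I -> T -> Rr) : Prop :=
  (forall i, measurable_fun setT (g i)) /\
  (forall i (A : set Rr), measurable A -> P (g i @^-1` A) = normal_prob 0 1 A) /\
  (forall A : I -> set Rr, (forall i, measurable (A i)) ->
     P (\bigcap_(i in [set: I]) (g i @^-1` A i)) =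
     (\prod_(i : I) P (g i @^-1` A i))%E).

End Defs.

(* Main.v *)
Require Import Defs.
From HB Require Import structures.
From mathcomp Require Import all_boot all_order all_algebra all_fingroup.
From mathcomp Require Import mxrepresentation complex.
From mathcomp Require Import all_classical all_reals all_analysis.
From mathcomp Require Import pgroup measurable_realfun normal_distribution ring lra.
Set Implicit Arguments.
Unset Strict Implicit.
Unset Printing Implicit Defensive.
Import Order.TTheory GRing.Theory Num.Theory.
Import numFieldNormedType.Exports.
Local Open Scope classical_set_scope.
Local Open Scope ring_scope.

(* Write [B = |H1| rho(H1) - |H2| rho(H2)], a Hermitian matrix. By Schur orthogonality the outcome
   [(rho, i, t)] separates the two states by [b_t^* B b_t / (|G| ell)], where [b_t] is a Gaussian
   vector of [C^(d_rho)], and for fixed [(rho, i)] the differences over all outcomes add up to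
   [tr B / |G|]; the triangle inequality then bounds the distance from below by [w(H1, H2)] for
   every choice of the POVM.

   For the Frobenius term it suffices that, with probability [1 - exp (- Omega(m_rho))], the sum
   of [|b_t^* B b_t|] is at least of order [m_rho |B|_F] while [ell = O(m_rho)].

   - If [X'] is an independent copy of [X = b^* B b], then [(E e^{-|X|})^2 <= E e^{-|X - X'|}], and
     a rotation by 45 degrees turns [X - X'] into a bilinear form in two independent Gaussian
     vectors. Conditionally on one of them it is a centered Gaussian variable, and Jensen's
     inequality over the rows of [B] reduces the estimate to [E e^{-2|xy|} < 1] for two independent
     standard normal variables. Independence over [t] and Markov's inequality conclude.
   - [ell] is bounded through the bilinear form of a real Gaussian matrix on a finite grid of pairs
     of vectors of the unit balls, where the form has Gaussian tails.

   A union bound over the at most [|G|] irreducible representations finishes the proof. *)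

(** * Independent Gaussian families *)

Section GaussianFamily.
Context {R : realType}.
Local Notation N01 := (@normal_prob R 0 1).

(** Marginals and independence are merged into one product formula over full rectangles; sides equal
    to [setT] recover every subfamily, as in [gaussian_family_marginal]. *)
Definition gaussian_family d (T : measurableType d) (P : probability T R)
    (I : finType) (g : I -> T -> R) : Prop :=
  (forall i, measurable_fun setT (g i)) /\
  (forall A : I -> set R, (forall i, measurable (A i)) ->
     P [set w | forall i, A i (g i w)] = (\prod_(i : I) N01 (A i))%E).

(** The rectangles form a pi-system, and the sigma-algebra that they generate is the product
    sigma-algebra on functions from [I] to [R]. *)
Definition rect (I : finType) : set (set (I -> R)) :=
  [set B | exists2 A : I -> set R,
     (forall i, measurable (A i)) & B = [set x | forall i, A i (x i)]].

Local Notation fspace I := (g_sigma_algebraType (@rect I)).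

Lemma measurable_coord (I : finType) (i : I) :
  measurable_fun [set: fspace I] (fun x : fspace I => (x : I -> R) i).
Proof.
move=> _ B mB; rewrite setTI; apply: sub_sigma_algebra.
exists (fun j => if j == i then B else setT) => [j|]; first by case: ifP.
apply/seteqP; split => x /=.
  by move=> Bx j; case: eqP => // ->.
by move/(_ i); rewrite eqxx.
Qed.

Lemma measurable_family d (T : measurableType d) (I : finType) (g : I -> T -> R) :
  (forall i, measurable_fun setT (g i)) ->
  measurable_fun setT (fun w => (fun i => g i w) : fspace I).
Proof.
move=> mg; apply: (@measurability _ _ T (fspace I) _ _ (@rect I)) => //.
move=> _ [_ [A mA ->] <-]; rewrite setTI.
have -> : (fun w => (fun i => g i w) : fspace I) @^-1` [set x | forall i, A i (x i)] =
   \bigcap_(i in [set: I]) (g i @^-1` A i).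
  by apply/seteqP; split => w /= h i //=; exact: h.
apply: fin_bigcap_measurable => // i _.
by rewrite -[X in measurable X]setTI; exact: mg.
Qed.

Lemma measurable_comp_family d (T : measurableType d) d' (U : measurableType d')
    (I : finType) (g : I -> T -> R) (F : fspace I -> U) :
  (forall i, measurable_fun setT (g i)) -> measurable_fun [set: fspace I] F ->
  measurable_fun setT (fun w => F (fun i => g i w)).
Proof. by move=> mg mF; exact: (measurableT_comp mF (measurable_family mg)). Qed.

(** The two laws agree on the pi-system of rectangles, hence everywhere. This allows the underlying
    probability space to be replaced by a product on which chosen coordinates come from separate
    factors. *)
Lemma gaussian_family_law d (T : measurableType d) (P : probability T R)
    d' (T' : measurableType d') (P' : probability T' R) (I : finType)
    (g : I -> T -> R) (g' : I -> T' -> R) (F : fspace I -> \bar R) :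
  gaussian_family P g -> gaussian_family P' g' ->
  measurable_fun [set: fspace I] F -> (forall x, 0 <= F x)%E ->
  (\int[P]_w F (fun i => g i w) = \int[P']_w F (fun i => g' i w))%E.
Proof.
move=> [mg Pg] [mg' Pg'] mF F0.
have m1 := measurable_family mg; have m2 := measurable_family mg'.
have e1 := @ge0_integral_pushforward _ _ T (fspace I) R _ m1 P setT F measurableT mF
  (fun x _ => F0 x).
have e2 := @ge0_integral_pushforward _ _ T' (fspace I) R _ m2 P' setT F measurableT mF
  (fun x _ => F0 x).
rewrite /= preimage_setT in e1; rewrite /= preimage_setT in e2.
rewrite -e1 -e2; apply: eq_measure_integral => A mA _.
pose M1 : {measure set (fspace I) -> \bar R} :=
  pushforward P (fun w => (fun i => g i w) : fspace I).
pose M2 : {measure set (fspace I) -> \bar R} :=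
  pushforward P' (fun w => (fun i => g' i w) : fspace I).
rewrite -[LHS]/(M1 m1 A) -[RHS]/(M2 m2 A).
apply: (@measure_unique _ R (fspace I) (@rect I) (fun=> setT)) => //.
- move=> _ _ [A1 mA1 ->] [A2 mA2 ->]; exists (fun i => A1 i `&` A2 i).
    by move=> i; exact: measurableI.
  by apply/seteqP; split => x /= => [[h1 h2] i|h]; [split|split=> i; have [] := h i].
- by move=> _; exists (fun=> setT) => //; apply/seteqP; split.
- by rewrite bigcup_const//; exists 0%N.
- move=> _ [B mB ->]; rewrite /= /pushforward.
  by rewrite -[LHS]/(P [set w | forall i, B i (g i w)])
    -[RHS]/(P' [set w | forall i, B i (g' i w)]) Pg// Pg'.
- by move=> _; rewrite -[X in (X < _)%E]/(P setT) probability_setT ltry.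
Qed.

End GaussianFamily.

Notation fspace R I := (g_sigma_algebraType (@rect R I)).

(** * Product of two probability spaces *)

Section ProductProbability.
Context {R : realType} d1 d2 (T1 : measurableType d1) (T2 : measurableType d2).
Variables (P1 : probability T1 R) (P2 : probability T2 R).

Definition pprod : set (T1 * T2) -> \bar R := (P1 \x P2)%E.

HB.instance Definition _ := Measure.on pprod.

Let pprod_setT : pprod setT = 1%E.
Proof.
have -> : pprod setT = (P1 setT * P2 setT)%E.
  by rewrite -setXTT [LHS]product_measure1E.
by rewrite !probability_setT mule1.
Qed.

HB.instance Definition _ := @Measure_isProbability.Build _ _ R pprod pprod_setT.

Lemma pprodE (A : set T1) (B : set T2) : measurable A -> measurable B ->
  pprod (A `*` B) = (P1 A * P2 B)%E.
Proof. exact: product_measure1E. Qed.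

Lemma integral_pprod1 (f : T1 * T2 -> \bar R) : measurable_fun setT f ->
  (forall x, 0 <= f x)%E ->
  (\int[pprod]_z f z = \int[P1]_x \int[P2]_y f (x, y))%E.
Proof. by move=> mf f0; exact: fubini_tonelli1. Qed.

Lemma integral_pprod2 (f : T1 * T2 -> \bar R) : measurable_fun setT f ->
  (forall x, 0 <= f x)%E ->
  (\int[pprod]_z f z = \int[P2]_y \int[P1]_x f (x, y))%E.
Proof. by move=> mf f0; exact: fubini_tonelli2. Qed.

Lemma measurable_integral_fst (f : T1 * T2 -> \bar R) : measurable_fun setT f ->
  (forall x, 0 <= f x)%E -> measurable_fun setT (fun y => \int[P1]_x f (x, y))%E.
Proof. by move=> mf f0; exact: measurable_fun_fubini_tonelli_G. Qed.

Lemma measurable_integral_snd (f : T1 * T2 -> \bar R) : measurable_fun setT f ->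
  (forall x, 0 <= f x)%E -> measurable_fun setT (fun x => \int[P2]_y f (x, y))%E.
Proof. by move=> mf f0; exact: measurable_fun_fubini_tonelli_F. Qed.

End ProductProbability.

Section Independence.
Context {R : realType} d (T : measurableType d) (P : probability T R).
Variables (I : finType) (g : I -> T -> R).
Hypothesis gP : gaussian_family P g.
Local Notation N01 := (@normal_prob R 0 1).

Lemma gaussian_family_marginal (J : pred I) (A : I -> set R) :
  (forall i, measurable (A i)) ->
  P [set w | forall i, J i -> A i (g i w)] = (\prod_(i | J i) N01 (A i))%E.
Proof.
move=> mA; have := gP.2 (fun i => if J i then A i else setT).
rewrite (_ : [set w | _] = [set w | forall i, J i -> A i (g i w)]); last first.
  apply/seteqP; split => w /= h i; first by move=> Ji; have := h i; rewrite Ji.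
  by case: ifP => // Ji; exact: h.
move=> ->; last by move=> i; case: ifP.
rewrite [RHS]big_mkcond /=; apply: eq_bigr => i _.
by case: ifP => // _; rewrite probability_setT.
Qed.

(** Coordinates in [J] are read off the first factor and the others off the second, so that Fubini
    can separate two groups of coordinates that originally live on a single space. *)
Lemma gaussian_family_mix d' (T' : measurableType d') (P' : probability T' R)
    (g' : I -> T' -> R) (J : pred I) : gaussian_family P' g' ->
  gaussian_family (pprod P P')
    (fun i w => if J i then g i w.1 else g' i w.2).
Proof.
move=> g'P; split=> [i|A mA].
  by case: (J i); apply: measurableT_comp => //; [exact: gP.1|exact: g'P.1].
rewrite (_ : [set w | _] = [set w | forall i, J i -> A i (g i w)] `*`
   [set w | forall i, ~~ J i -> A i (g' i w)]); last first.
  apply/seteqP; split => [[w w']/= h|[w w']/= [h h'] i]; last first.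
    by case: ifP => Ji; [exact: h|apply: h'; rewrite Ji].
  by split=> i Ji; have := h i; [rewrite Ji|rewrite (negbTE Ji)].
have mS d0 (T0 : measurableType d0) (f : I -> T0 -> R) (K : pred I) :
    (forall i, measurable_fun setT (f i)) ->
    measurable [set w | forall i, K i -> A i (f i w)].
  move=> mf; rewrite (_ : [set w | _] = \bigcap_(i in [set i | K i]) (f i @^-1` A i)) //.
  apply: fin_bigcap_measurable => // i _.
  by rewrite -[X in measurable X]setTI; exact: mf.
rewrite [LHS]pprodE; [|exact: mS gP.1|exact: mS g'P.1].
rewrite gaussian_family_marginal// [RHS](bigID J)/=; congr (_ * _)%E.
have := g'P.2 (fun i => if ~~ J i then A i else setT).
rewrite (_ : [set w | _] = [set w | forall i, ~~ J i -> A i (g' i w)]); last first.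
  apply/seteqP; split => w /= h i; first by move=> Ji; have := h i; rewrite Ji.
  by case: ifP => // Ji; exact: h.
move=> ->; last by move=> i; case: ifP.
rewrite [RHS]big_mkcond /=; apply: eq_bigr => i _.
by case: ifP => // _; rewrite probability_setT.
Qed.

(** Induction on [s]: once block [k] sits on one factor of a product space and the other blocks on
    the second, [phi k] sees only the first factor and the remaining product only the second. *)
Lemma gaussian_family_block (K : eqType) (pi : I -> K) (s : seq K)
    (phi : K -> fspace R I -> \bar R) : uniq s ->
  (forall k, measurable_fun [set: fspace R I] (phi k)) ->
  (forall k x, 0 <= phi k x)%E ->
  (forall k x y, (forall i, pi i = k -> x i = y i) -> phi k x = phi k y) ->
  (\int[P]_w \prod_(k <- s) phi k (fun i => g i w) =
   \prod_(k <- s) \int[P]_w phi k (fun i => g i w))%E.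
Proof.
move=> us mphi phi0 phiE.
have prod0 (r : seq K) x : (0 <= \prod_(k <- r) phi k x)%E.
  by elim/big_ind : _ => // a b; exact: mule_ge0.
have mprod (r : seq K) :
    measurable_fun [set: fspace R I] (fun x => \prod_(k <- r) phi k x)%E.
  elim: r => [|k r IH].
    by rewrite (_ : (fun x => _) = cst 1%E)//; apply/funext => x; rewrite big_nil.
  rewrite (_ : (fun x => _) = (fun x => phi k x * \prod_(k <- r) phi k x)%E).
    exact: emeasurable_funM.
  by apply/funext => x; rewrite big_cons.
elim: s us => [_|k s IH /= /andP[ks us]].
  under eq_integral do rewrite big_nil.
  by rewrite big_nil integral_cst//= probability_setT mule1.
have mixP := gaussian_family_mix (fun i => pi i == k) gP.
rewrite (gaussian_family_law (F := fun x => \prod_(k <- k :: s) phi k x)%E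
  gP mixP (mprod _) (prod0 _)).
rewrite integral_pprod1//=; last first.
  exact: (measurable_comp_family (g := fun i (w : T * T) => _) mixP.1 (mprod (k :: s))).
rewrite [RHS]big_cons -IH//.
rewrite -ge0_integralZr//=; last 2 first.
- exact: measurable_comp_family gP.1 (mphi k).
- by apply: integral_ge0 => *; exact: prod0.
apply: eq_integral => w _.
rewrite -ge0_integralZl//=; last first.
  exact: measurable_comp_family gP.1 (mprod s).
apply: eq_integral => w' _; rewrite big_cons; congr (_ * _)%E.
  by apply: phiE => i ->; rewrite eqxx.
apply: eq_big_seq => j js; apply: phiE => i ij; case: eqP => // ik.
by move: ks; rewrite -ik ij js.
Qed.

End Independence.

(** * The standard normal distribution *)

Section StandardNormal.
Context {R : realType}.
Local Notation N01 := (@normal_prob R 0 1).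
Local Notation mu := (@lebesgue_measure R).
Local Notation pdf := (@normal_pdf R 0 1).

(** The Radon-Nikodym derivative of [N01] and the density [pdf] have equal integrals over every
    measurable set, so they agree almost everywhere. *)
Lemma integral_normal01 (f : R -> \bar R) : measurable_fun setT f ->
  (forall x, 0 <= f x)%E ->
  (\int[N01]_x f x = \int[mu]_x (f x * (pdf x)%:E))%E.
Proof.
move=> mf f0; have dom := @normal_prob_dominates R 0 1.
rewrite -(Radon_Nikodym_SigmaFinite.change_of_variables dom f0 measurableT mf).
apply: ae_eq_integral => //.
- apply: emeasurable_funM => //; apply: measurable_int.
  exact: Radon_Nikodym_SigmaFinite.f_integrable.
- apply: emeasurable_funM => //; apply/measurable_EFinP.
  exact: measurable_normal_pdf.
- apply: ae_eqe_mul2l; apply: integral_ae_eq => //.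
  + exact: Radon_Nikodym_SigmaFinite.f_integrable.
  + by apply/measurable_EFinP; exact: measurable_normal_pdf.
  + by move=> E _ mE; rewrite -Radon_Nikodym_SigmaFinite.f_integral.
Qed.

(** Pushing Lebesgue measure forward along [x |-> a x + b] and scaling it by [a] gives half-open
    intervals their length, which determines the measure. *)
Lemma integral_lebesgue_affine (f : R -> \bar R) (a b : R) : 0 < a ->
  measurable_fun setT f -> (forall x, 0 <= f x)%E ->
  (\int[mu]_x f x = a%:E * \int[mu]_x f (a * x + b)%R)%E.
Proof.
move=> a0 mf f0.
pose phi : R -> measurableTypeR R := fun x => a * x + b.
have mphi : measurable_fun setT phi.
  by apply: measurable_funD => //; exact: measurable_funM.
pose nu : {measure set (measurableTypeR R) -> \bar R} :=
  mscale (NngNum (ltW a0)) (pushforward mu phi).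
have muE A : measurable A -> mu A = nu mphi A.
  apply: lebesgue_measure_unique => _ [[x y] _ <-].
  rewrite /nu /= /mscale /= /pushforward.
  have -> : phi @^-1` `]x, y]%classic = `](x - b) / a, (y - b) / a]%classic.
    apply/seteqP; split => z /=; rewrite !in_itv /= /phi;
      by rewrite ltr_pdivrMr// ler_pdivlMr// lerBrDr ltrBlDr (mulrC a).
  rewrite !lebesgue_measure_itv /= !lte_fin.
  rewrite ltr_pM2r ?invr_gt0// ltrD2r; case: ifPn => _; last by rewrite mule0.
  by rewrite -!EFinD -EFinM; congr EFin; field; rewrite gt_eqF.
transitivity (\int[nu mphi]_x f x)%E.
  by apply: eq_measure_integral => A mA _; exact: muE.
rewrite ge0_integral_mscale//; congr (_ * _)%E.
by rewrite ge0_integral_pushforward.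
Qed.

Lemma measurable_affine (f : R -> \bar R) (a b : R) : measurable_fun setT f ->
  measurable_fun setT (fun x => f (a * x + b)%R).
Proof.
move=> mf; apply: (measurableT_comp mf).
by apply: measurable_funD => //; exact: measurable_funM.
Qed.

Lemma normal01E (x : R) : pdf x = normal_peak 1 * expR (- (x ^+ 2 / 2)).
Proof.
by rewrite normal_pdfE ?oner_neq0// /normal_fun subr0 expr1n mulNr.
Qed.

Lemma measurable_pdf : measurable_fun setT pdf.
Proof. exact: measurable_normal_pdf. Qed.

(* Carried out as two one-dimensional substitutions (shears), [u = c x + s y] at fixed [y] and
   then [v = (y - s u) / c] at fixed [u]. *)
Lemma normal01_rotation (f : R * R -> \bar R) (c s : R) : 0 < c ->
  c ^+ 2 + s ^+ 2 = 1 -> measurable_fun setT f -> (forall x, 0 <= f x)%E ->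
  (\int[N01]_x \int[N01]_y f (c * x + s * y, c * y - s * x)%R =
   \int[N01]_x \int[N01]_y f (x, y))%E.
Proof.
move=> c0 cs mf f0; have c0' : c != 0 by rewrite gt_eqF.
have c2 : 1 - s ^+ 2 = c ^+ 2 by rewrite -cs addrK.
have mp := measurable_pdf.
have p0 x : 0 <= pdf x by exact: normal_pdf_ge0.
have mfc d (T : measurableType d) (u v : T -> R) : measurable_fun setT u ->
    measurable_fun setT v -> measurable_fun setT (fun t => f (u t, v t)).
  by move=> mu_ mv; apply: (measurableT_comp mf); exact: measurable_fun_pair.
have m1 (a : R) : measurable_fun setT (fun x : R => a * x) by exact: measurable_funM.
pose F1 := fun z : R * R => f (c * z.1 + s * z.2, c * z.2 - s * z.1)%R.
have F10 z : (0 <= F1 z)%E by exact: f0.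
have mF1 : measurable_fun setT F1.
  apply: mfc.
    by apply: measurable_funD; apply: measurableT_comp (m1 _) _.
  by apply: measurable_funB; apply: measurableT_comp (m1 _) _.
transitivity (\int[N01]_y \int[N01]_x F1 (x, y))%E.
  apply: (etrans (esym (integral_pprod1 N01 N01 mF1 _)) (integral_pprod2 N01 N01 mF1 _));
    by move=> z; exact: f0.
have mF1x y : measurable_fun setT (fun x => F1 (x, y)).
  by rewrite /F1 /=; apply: mfc; [apply: measurable_funD|apply: measurable_funB] => //; exact: m1.
(* [h] is the integrand against Lebesgue measure after the first shear: [z.1] is the new variable
   [u], [z.2] is still [y], and the old [x] has become [(u - s y) / c]. *)
pose h := fun z : R * R =>
  (f (z.1, (z.2 - s * z.1) / c)%R * (pdf ((z.1 - s * z.2) / c) * pdf z.2 / c)%:E)%E.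
have h0 z : (0 <= h z)%E.
  by rewrite mule_ge0// lee_fin divr_ge0// ?(ltW c0)// mulr_ge0.
have mh : measurable_fun setT h.
  apply: emeasurable_funM.
    apply: mfc => //; apply: measurable_funM => //.
    by apply: measurable_funB => //; apply: measurableT_comp (m1 _) _.
  apply/measurable_EFinP; apply: measurable_funM => //; apply: measurable_funM.
    apply: (measurableT_comp mp); apply: measurable_funM => //.
    by apply: measurable_funB => //; apply: measurableT_comp (m1 _) _.
  exact: measurableT_comp.
transitivity (\int[mu]_y \int[mu]_u h (u, y))%E.
  rewrite integral_normal01//; last 2 first.
  - by apply: (measurable_integral_fst N01 mF1) => z; exact: f0.
  - by move=> y; apply: integral_ge0 => x _; exact: f0.
  apply: eq_integral => y _.
  have mA : measurable_fun setT (fun x => F1 (x, y) * (pdf x)%:E)%E.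
    by apply: emeasurable_funM => //; exact/measurable_EFinP.
  have A0 x : (0 <= F1 (x, y) * (pdf x)%:E)%E by rewrite mule_ge0// lee_fin.
  rewrite (integral_normal01 (mF1x y))//.
  rewrite -(ge0_integralZr mu measurableT mA) ?lee_fin//.
  have mB : measurable_fun setT (fun x => F1 (x, y) * (pdf x)%:E * (pdf y)%:E)%E.
    by apply: emeasurable_funM.
  have B0 x : (0 <= F1 (x, y) * (pdf x)%:E * (pdf y)%:E)%E.
    by rewrite mule_ge0// lee_fin.
  rewrite (@integral_lebesgue_affine _ c^-1 (- (s * y / c)) _ mB) ?invr_gt0//.
  have mC := measurable_affine c^-1 (- (s * y / c)) mB.
  rewrite -(ge0_integralZl mu measurableT mC) ?lee_fin ?invr_ge0 ?(ltW c0)//.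
  apply: eq_integral => u _; rewrite /h /F1 /= muleC -!muleA -!EFinM.
  congr (f (_, _) * _%:E)%E.
  - by field.
  - rewrite (_ : c * y = (c ^+ 2 + s ^+ 2) * y / c - s ^+ 2 * y / c); last by field.
    by rewrite cs; field.
  - rewrite mulrA; congr (pdf _ * _ / _); by field.
transitivity (\int[mu]_u \int[mu]_y h (u, y))%E.
  by apply: esym; apply: (@fubini_tonelli _ _ _ _ R mu mu h mh h0).
rewrite integral_normal01//; last 2 first.
- exact: (measurable_integral_snd N01 mf).
- by move=> y; apply: integral_ge0 => x _; exact: f0.
apply: eq_integral => u _.
have mfu : measurable_fun setT (fun v => f (u, v)) by apply: mfc.
have mA : measurable_fun setT (fun x => f (u, x) * (pdf x)%:E)%E.
  by apply: emeasurable_funM => //; exact/measurable_EFinP.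
have A0 x : (0 <= f (u, x) * (pdf x)%:E)%E by rewrite mule_ge0// lee_fin.
rewrite (integral_normal01 mfu)//.
rewrite -(ge0_integralZr mu measurableT mA) ?lee_fin//.
have mhu : measurable_fun setT (fun y => h (u, y)).
  by apply: (measurableT_comp mh); exact: measurable_fun_pair.
rewrite (@integral_lebesgue_affine _ c (s * u) _ mhu)//.
have mC := measurable_affine c (s * u) mhu.
rewrite -(ge0_integralZl mu measurableT mC) ?lee_fin ?(ltW c0)//.
apply: eq_integral => v _; rewrite /h /=.
rewrite (_ : (_ - _) / c = v); last by field.
rewrite (_ : (u - _) / c = (1 - s ^+ 2) / c * u - s * v); last by field.
rewrite c2 (_ : c ^+ 2 / c = c); last by field.
rewrite muleC -!muleA -!EFinM; congr (_ * _%:E)%E.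
(* Only the Gaussian exponents remain to be compared; they agree because the rotation preserves
   [u^2 + v^2]. *)
rewrite !normal01E.
rewrite (_ : _ / c * c = normal_peak 1 ^+ 2 *
  (expR (- ((c * u - s * v) ^+ 2 / 2)) * expR (- ((c * v + s * u) ^+ 2 / 2)))); last by field.
transitivity (normal_peak 1 ^+ 2 * (expR (- (v ^+ 2 / 2)) * expR (- (u ^+ 2 / 2)))); last by ring.
rewrite -!expRD; congr (_ * expR _).
transitivity (- ((c ^+ 2 + s ^+ 2) * (v ^+ 2 + u ^+ 2) / 2)); first by field.
by rewrite cs; field.
Qed.

(** Completing the square turns the integrand into a constant times the normal density centred at
    [l]. *)
Lemma normal01_mgf (l : R) : (\int[N01]_x (expR (l * x))%:E = (expR (l ^+ 2 / 2))%:E)%E.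
Proof.
rewrite integral_normal01; last 2 first.
- by apply/measurable_EFinP; apply: measurableT_comp => //; exact: measurable_funM.
- by move=> x; rewrite lee_fin expR_ge0.
transitivity (\int[mu]_x ((expR (l ^+ 2 / 2))%:E * (normal_pdf l 1 x)%:E))%E.
  apply: eq_integral => x _; rewrite -!EFinM normal01E; congr EFin.
  rewrite normal_pdfE ?oner_neq0// /normal_fun expr1n.
  rewrite mulrCA [RHS]mulrCA -!expRD; congr (_ * expR _); by field.
have mp : measurable_fun setT (fun x => (normal_pdf l 1 x)%:E).
  by apply/measurable_EFinP; exact: measurable_normal_pdf.
rewrite (ge0_integralZl mu measurableT mp) ?lee_fin ?expR_ge0//; last first.
  by move=> x _; rewrite lee_fin normal_pdf_ge0.
by rewrite integral_normal_pdf mule1.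
Qed.

End StandardNormal.

(** * Linear forms *)

Section FiniteSums.
Context {R : realType}.

(** Cauchy-Schwarz: the sum of the squares [(B a_i - S b_i)^2] is nonnegative and equals
    [B (A B - S^2)]. *)
Lemma sum_mul_le (I : finType) (a b : I -> R) :
  (\sum_i a i * b i) ^+ 2 <= (\sum_i a i ^+ 2) * (\sum_i b i ^+ 2).
Proof.
set A := \sum_i a i ^+ 2; set B := \sum_i b i ^+ 2; set S := \sum_i a i * b i.
have B0 : 0 <= B by apply: sumr_ge0 => i _; exact: sqr_ge0.
have : 0 <= \sum_i (B * a i - S * b i) ^+ 2 by apply: sumr_ge0 => i _; exact: sqr_ge0.
have -> : \sum_i (B * a i - S * b i) ^+ 2 = B * (A * B - S ^+ 2).
  rewrite (eq_bigr (fun i => B ^+ 2 * a i ^+ 2 - 2 * B * S * (a i * b i) + S ^+ 2 * b i ^+ 2)).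
    by rewrite big_split /= sumrB -!mulr_sumr -/A -/B -/S; ring.
  by move=> i _; ring.
have [B00|Bn0] := eqVneq B 0; last by rewrite pmulr_rge0 ?subr_ge0// lt_neqAle eq_sym Bn0.
have b0 i : b i = 0.
  apply/eqP; rewrite -sqrf_eq0; apply/eqP.
  by apply: (psumr_eq0P (P := predT) (F := fun i => b i ^+ 2)) => // j _; exact: sqr_ge0.
by rewrite B00 mulr0 /S big1 ?expr0n// => i _; rewrite b0 mulr0.
Qed.

(** Jensen's inequality through the tangent line of the exponential at the weighted mean:
    [e^(- a) >= e^(- m) (1 + m - a)], summed against the weights. *)
Lemma expR_jensen (I : finType) (w a : I -> R) : (forall i, 0 <= w i) ->
  \sum_i w i = 1 -> expR (- \sum_i w i * a i) <= \sum_i w i * expR (- a i).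
Proof.
move=> w0 w1; set m := \sum_i w i * a i.
have -> : expR (- m) = \sum_i w i * (expR (- m) * (1 + (m - a i))).
  rewrite (eq_bigr (fun i => expR (- m) * (1 + m) * w i - expR (- m) * (w i * a i))).
    by rewrite sumrB -!mulr_sumr w1 -/m; ring.
  by move=> i _; ring.
apply: ler_sum => i _; apply: ler_wpM2l => //.
rewrite [X in _ <= expR X](_ : _ = - m + (m - a i)); last by ring.
by rewrite expRD; apply: ler_wpM2l; [exact: expR_ge0|exact: expR_ge1Dx].
Qed.

Lemma measurable_bigsum d (T : measurableType d) (I : Type) (s : seq I) (f : I -> T -> R) :
  (forall i, measurable_fun setT (f i)) ->
  measurable_fun setT (fun x => \sum_(i <- s) f i x).
Proof.
move=> mf; elim: s => [|i s IH].
  by rewrite (_ : (fun x => _) = cst 0)//; apply/funext => x; rewrite big_nil.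
rewrite (_ : (fun x => _) = (fun x => f i x + \sum_(j <- s) f j x)).
  exact: measurable_funD.
by apply/funext => x; rewrite big_cons.
Qed.

End FiniteSums.

Lemma integral_probability_cst (R : realType) d (T : measurableType d)
    (P : probability T R) (k : \bar R) : (\int[P]_x k = k)%E.
Proof. by rewrite integral_cst//= probability_setT mule1. Qed.

Section LinearForms.
Context {R : realType}.
Local Notation N01 := (@normal_prob R 0 1).
Local Notation mu := (@lebesgue_measure R).
Local Notation pdf := (@normal_pdf R 0 1).

Lemma normal01_opp (f : R -> \bar R) : measurable_fun setT f ->
  (forall x, 0 <= f x)%E -> (\int[N01]_x f (- x)%R = \int[N01]_x f x)%E.
Proof.
move=> mf f0.
have mo : measurable_fun setT (-%R : measurableTypeR R -> measurableTypeR R) by [].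
have mfo : measurable_fun setT (fun x : R => f (- x)%R) by exact: (measurableT_comp mf).
rewrite (integral_normal01 mfo)// (integral_normal01 mf)//.
have mg : measurable_fun setT (fun x => f x * (pdf x)%:E)%E.
  by apply: emeasurable_funM => //; apply/measurable_EFinP; exact: measurable_pdf.
have g0 x : (0 <= f x * (pdf x)%:E)%E.
  by rewrite mule_ge0// lee_fin normal_pdf_ge0.
pose nu : {measure set (measurableTypeR R) -> \bar R} :=
  pushforward mu (-%R : measurableTypeR R -> measurableTypeR R).
transitivity (\int[nu mo]_x (f x * (pdf x)%:E))%E; last first.
  by apply: eq_measure_integral => A mA _; exact: lebesgue_measureN.
have e := @ge0_integral_pushforward _ _ (measurableTypeR R) (measurableTypeR R) R _ mo mu setT _
  measurableT mg (fun x _ => g0 x).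
rewrite preimage_setT in e; rewrite [RHS]e; apply: eq_integral => x _ /=.
by rewrite !normal01E sqrrN.
Qed.

(** A rotation with cosine [a / t] and sine [b / t], where [t^2 = a^2 + b^2], turns the combination
    into [t] times the first coordinate. The rotation lemma wants a positive cosine, so [a = 0] is
    treated apart, by the symmetry of the law. *)
Lemma normal01_lin2 (f : R -> \bar R) (a b : R) : 0 <= a -> measurable_fun setT f ->
  (forall x, 0 <= f x)%E ->
  (\int[N01]_x \int[N01]_y f (a * x + b * y)%R =
   \int[N01]_x f (Num.sqrt (a ^+ 2 + b ^+ 2) * x)%R)%E.
Proof.
move=> a0 mf f0.
have mfs (k : R) : measurable_fun setT (fun x => f (k * x)%R).
  by apply: (measurableT_comp mf); exact: measurable_funM.
have [a00|an0] := eqVneq a 0.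
  rewrite a00 expr0n add0r sqrtr_sqr.
  transitivity (\int[N01]_x \int[N01]_y f (b * y)%R)%E.
    by apply: eq_integral => x _; apply: eq_integral => y _; rewrite mul0r add0r.
  rewrite (integral_probability_cst N01).
  have [b0|b0] := leP 0 b; first by rewrite ger0_norm.
  rewrite ltr0_norm// -[LHS]normal01_opp//.
  by apply: eq_integral => x _; rewrite mulrN mulNr.
have {an0}a0 : 0 < a by rewrite lt_neqAle eq_sym an0.
set t := Num.sqrt _.
have t2 : t ^+ 2 = a ^+ 2 + b ^+ 2 by rewrite sqr_sqrtr// addr_ge0// sqr_ge0.
have t0 : 0 < t by rewrite sqrtr_gt0 ltr_wpDr ?sqr_ge0// exprn_gt0.
have t00 : t != 0 by rewrite gt_eqF.
pose F := fun z : R * R => f (t * z.1)%R.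
have mF : measurable_fun setT F by exact: (measurableT_comp (mfs t)).
have cs : (a / t) ^+ 2 + (b / t) ^+ 2 = 1.
  by rewrite !expr_div_n -mulrDl -t2 divff// expf_neq0.
transitivity (\int[N01]_x \int[N01]_y F (a / t * x + b / t * y, a / t * y - b / t * x)%R)%E.
  apply: eq_integral => x _; apply: eq_integral => y _; rewrite /F /=.
  by congr f; field.
rewrite (normal01_rotation _ cs mF) ?divr_gt0//; last by move=> z; exact: f0.
apply: eq_integral => x _; rewrite /F /=.
by rewrite (integral_probability_cst N01).
Qed.

Context d (T : measurableType d) (P : probability T R) (I : finType) (g : I -> T -> R).
Hypothesis gP : gaussian_family P g.

Lemma gaussian_family_coord (i : I) (f : R -> \bar R) : measurable_fun setT f ->
  (forall x, 0 <= f x)%E -> (\int[P]_w f (g i w) = \int[N01]_x f x)%E.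
Proof.
move=> mf f0.
have mg : measurable_fun setT (g i : T -> measurableTypeR R) by exact: gP.1.
pose nu : {measure set (measurableTypeR R) -> \bar R} :=
  pushforward P (g i : T -> measurableTypeR R).
transitivity (\int[nu mg]_x f x)%E.
  have e := @ge0_integral_pushforward _ _ _ _ R _ mg P setT _ measurableT mf (fun x _ => f0 x).
  by rewrite preimage_setT in e; rewrite [RHS]e.
apply: (@eq_measure_integral _ _ _ setT N01 (nu mg)) => A mA _.
have := gaussian_family_marginal gP (pred1 i) (A := fun=> A) (fun=> mA).
rewrite big_pred1_eq => e; apply: etrans e; rewrite /= /pushforward; congr (P _).
apply/seteqP; split => w /=; first by move=> ? j /eqP ->.
by apply; rewrite eqxx.
Qed.

(** Coordinate [k] is put on its own factor of a product space; the induction hypothesis reduces the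
    remaining sum to one normal variable, and [normal01_lin2] merges the two. The induction is
    uniform in [f], which has to absorb the shift by coordinate [k]. *)
Lemma gaussian_family_lin_seq (c : I -> R) (s : seq I) (f : R -> \bar R) : uniq s ->
  measurable_fun setT f -> (forall x, 0 <= f x)%E ->
  (\int[P]_w f (\sum_(i <- s) c i * g i w)%R =
   \int[N01]_x f (Num.sqrt (\sum_(i <- s) c i ^+ 2) * x)%R)%E.
Proof.
elim: s f => [f _ _ _|k s IH f /= /andP[ks us] mf f0].
  rewrite big_nil sqrtr0.
  under eq_integral do rewrite big_nil.
  under [in RHS]eq_integral do rewrite mul0r.
  by rewrite (integral_probability_cst P) (integral_probability_cst N01).
have mF (r : seq I) : measurable_fun [set: fspace R I]
    (fun x : fspace R I => \sum_(i <- r) c i * (x : I -> R) i).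
  apply: measurable_bigsum => i; apply: measurable_funM => //.
  exact: measurable_coord.
have mixP := gaussian_family_mix gP (pred1 k) gP.
have mF' := measurableT_comp mf (mF (k :: s)).
rewrite (gaussian_family_law gP mixP mF')//=.
rewrite integral_pprod1//=; last exact: (measurable_comp_family mixP.1 mF').
set sg := \sum_(i <- s) c i ^+ 2.
pose h := fun y => (\int[N01]_x f (c k * y + Num.sqrt sg * x)%R)%E.
have mh2 : measurable_fun setT (fun z : R * R => f (c k * z.1 + Num.sqrt sg * z.2)%R).
  apply: (measurableT_comp mf); apply: measurable_funD.
    by apply: measurable_funM.
  by apply: measurable_funM.
have mh : measurable_fun setT h by apply: (measurable_integral_snd N01 mh2).
have h0 y : (0 <= h y)%E by apply: integral_ge0.
transitivity (\int[P]_w h (g k w))%E.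
  apply: eq_integral => w _; rewrite /h.
  rewrite -(IH (fun x => f (c k * g k w + x)%R) us)//; last first.
    by apply: (measurableT_comp mf); exact: measurable_funD.
  apply: eq_integral => w' _; rewrite big_cons eqxx; congr (f (_ + _)).
  apply: eq_big_seq => j js; case: eqP => // jk; by rewrite -jk js in ks.
rewrite gaussian_family_coord// /h big_cons.
(* The integrals are exchanged because [normal01_lin2] asks for a nonnegative first coefficient, and
   [c k] may be negative. *)
transitivity (\int[N01]_x \int[N01]_y f (Num.sqrt sg * x + c k * y)%R)%E.
  rewrite -(integral_pprod1 N01 N01 mh2)// (integral_pprod2 N01 N01 mh2)//=.
  by apply: eq_integral => x _; apply: eq_integral => y _; rewrite addrC.
rewrite normal01_lin2 ?sqrtr_ge0// sqr_sqrtr ?sumr_ge0// => [|i _]; last exact: sqr_ge0.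
by rewrite addrC.
Qed.

Lemma gaussian_family_lin (c : I -> R) (f : R -> \bar R) :
  measurable_fun setT f -> (forall x, 0 <= f x)%E ->
  (\int[P]_w f (\sum_i c i * g i w)%R =
   \int[N01]_x f (Num.sqrt (\sum_i c i ^+ 2) * x)%R)%E.
Proof. exact: gaussian_family_lin_seq (index_enum_uniq I). Qed.

End LinearForms.

(** * Rotation of two independent copies *)

Lemma integral_indicT (R : realType) d (T : measurableType d) (P : probability T R)
    (A : set T) : measurable A -> (\int[P]_x (\1_A x)%:E = P A)%E.
Proof. by move=> mA; rewrite integral_indic// setIT. Qed.

(** * A Laplace bound for the product of two normal variables *)

Section NormalBound.
Context {R : realType}.
Local Notation N01 := (@normal_prob R 0 1).
Local Notation mu := (@lebesgue_measure R).
Local Notation pdf := (@normal_pdf R 0 1).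

Lemma normal01_itv12_gt0 : 0 < fine (N01 `[1, 2]%classic).
Proof.
have p2 : 0 < pdf 2 by rewrite normal01E mulr_gt0 ?expR_gt0// normal_peak_gt0// oner_neq0.
rewrite fine_gt0//; apply/andP; split; last first.
  by rewrite (le_lt_trans (probability_le1 N01 _))// ltry.
have : ((pdf 2)%:E * mu `[1%R, 2%R]%classic <= N01 `[1%R, 2%R]%classic)%E.
  rewrite -integral_cst//; apply: ge0_le_integral => //.
  - by move=> x _; rewrite lee_fin ltW.
  - by apply/measurable_EFinP; apply: measurable_funTS; exact: measurable_pdf.
  - move=> x /=; rewrite in_itv /= => /andP[x1 x2].
    rewrite lee_fin !normal01E ler_wpM2l ?normal_peak_ge0// ler_expR lerN2.
    by rewrite ler_pM2r// lerXn2r// nnegrE; lra.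
apply: lt_le_trans; rewrite lebesgue_measure_itv /= lte_fin ltr1n -EFinD -EFinM lte_fin.
by apply: mulr_gt0 => //; lra.
Qed.

Lemma integral_normal01_indic2 (A : set R) (a b : R) : measurable A -> 0 <= a -> 0 <= b ->
  (\int[N01]_x (a * \1_A x + b * \1_(~` A) x)%:E =
    (a * fine (N01 A) + b * (1 - fine (N01 A)))%:E)%E.
Proof.
move=> mA a0 b0; have mA' := measurableC mA.
have ind (B : set R) (k : R) : measurable B -> 0 <= k ->
    (\int[N01]_x (k * \1_B x)%:E = (k * fine (N01 B))%:E)%E.
  move=> mB k0; under eq_integral do rewrite EFinM.
  have mi : measurable_fun setT (fun x => (\1_B x : R)%:E).
    by apply/measurable_EFinP; exact: measurable_indic.
  rewrite (ge0_integralZl N01 measurableT mi)//.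
  rewrite (integral_indicT N01)// EFinM fineK//; exact: fin_num_measure.
under eq_integral do rewrite EFinD.
have mi (B : set R) (k : R) : measurable B -> measurable_fun setT (fun x => (k * \1_B x : R)%:E).
  by move=> mB; apply/measurable_EFinP; apply: measurable_funM => //; exact: measurable_indic.
rewrite (ge0_integralD N01 measurableT _ (mi A a mA) _ (mi _ b mA')).
- rewrite !ind// -EFinD; congr (_ + _ * _)%:E.
  rewrite [N01 _](probability_setC N01 mA) fineB// fin_num_measure//.
- by move=> x _; rewrite lee_fin mulr_ge0.
- by move=> x _; rewrite lee_fin mulr_ge0.
Qed.

(** The integrand is at most 1 everywhere and at most [e^(- 2)] when both variables lie in [[1, 2]],
    an event of probability [p^2 > 0]; hence the constant [1 - (1 - e^(- 2)) p^2]. *)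
Lemma normal01_product_laplace : exists2 k : R, 0 <= k < 1 &
  (\int[N01]_x \int[N01]_y (expR (- (2 * (`|x| * `|y|))))%:E <= k%:E)%E.
Proof.
pose A : set R := `[1, 2]%classic; set p := fine (N01 A).
have p0 : 0 < p := normal01_itv12_gt0.
have mA : measurable A by exact: measurable_itv.
have p1 : p <= 1.
  by rewrite -lee_fin fineK ?probability_le1// fin_num_measure.
set e := expR (- 2) : R.
have e0 : 0 < e by exact: expR_gt0.
have e1 : e < 1 by rewrite /e -[ltRHS]expR0 ltr_expR; lra.
pose b x : R := 1 - (1 - e) * \1_A x.
have i01 (B : set R) x : 0 <= (\1_B x : R) <= 1 by rewrite indicE; case: (x \in B) => /=; lra.
have b0 x : 0 <= b x by rewrite /b; have := i01 A x; nra.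
have ptw x y : expR (- (2 * (`|x| * `|y|))) <= b x * \1_A y + 1 * \1_(~` A) y :> R.
  have le1 : expR (- (2 * (`|x| * `|y|))) <= 1 :> R.
    by rewrite -expR0 ler_expR oppr_le0 !mulr_ge0.
  rewrite !indicE in_setC; have [yA|yA] := boolP (y \in A);
    rewrite /= ?mulr0 ?add0r ?addr0 ?mulr1//.
  rewrite /b indicE; have [xA|xA] := boolP (x \in A); rewrite /= ?mulr0 ?subr0// mulr1.
  have -> : 1 - (1 - e) = e by ring.
  move: xA yA; rewrite !inE /A /= !in_itv /= => /andP[x1 _] /andP[y1 _].
  rewrite ler_expR lerN2 -[leLHS]mulr1 ler_pM2l//.
  rewrite -[leLHS]mulr1 ler_pM// ?(le_trans x1 (ler_norm x))//; exact: le_trans y1 (ler_norm y).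
have me x : measurable_fun setT (fun y : R => (expR (- (2 * (`|x| * `|y|))))%:E).
  apply/measurable_EFinP; apply: measurableT_comp => //; apply: measurableT_comp => //.
  by apply: measurable_funM => //; apply: measurable_funM => //; exact: measurableT_comp.
have ep0 : 0 < (1 - e) * p by rewrite mulr_gt0// subr_gt0.
have ep1 : (1 - e) * p <= 1 by rewrite mulr_ile1//; lra.
have epp0 : 0 < (1 - e) * p * p by rewrite mulr_gt0.
have epp1 : (1 - e) * p * p <= 1 by rewrite mulr_ile1// ltW.
exists (1 - (1 - e) * p * p); first by apply/andP; split; lra.
have mi (B : set R) (k : R) : measurable B -> measurable_fun setT (fun x => (k * \1_B x : R)).
  by move=> mB; apply: measurable_funM => //; exact: measurable_indic.
have mind (a c : R) : measurable_fun setT (fun y => (a * \1_A y + c * \1_(~` A) y : R)%:E).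
  by apply/measurable_EFinP; apply: measurable_funD; apply: mi => //; exact: measurableC.
pose h x : R := (1 - (1 - e) * p) * \1_A x + 1 * \1_(~` A) x.
apply: (@le_trans _ _ (\int[N01]_x (h x)%:E)%E).
  apply: ge0_le_integral => //.
  - by move=> x _; apply: integral_ge0 => y _; rewrite lee_fin expR_ge0.
  - have m2 : measurable_fun setT (fun z : R * R => (expR (- (2 * (`|z.1| * `|z.2|))))%:E).
      apply/measurable_EFinP; apply: measurableT_comp => //; apply: measurableT_comp => //.
      by apply: measurable_funM => //; apply: measurable_funM => //; exact: measurableT_comp.
    by apply: (measurable_integral_snd N01 m2) => z; rewrite lee_fin expR_ge0.
  - exact: mind.
  - move=> x _; apply: (@le_trans _ _ (\int[N01]_y (b x * \1_A y + 1 * \1_(~` A) y)%:E)%E).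
      apply: ge0_le_integral => //.
      + exact: me.
      + exact: mind.
      + by move=> y _; rewrite lee_fin.
    rewrite integral_normal01_indic2// lee_fin -/p /h /b.
    rewrite !indicE in_setC; case: (x \in A) => /=; lra.
rewrite /h integral_normal01_indic2//; last by lra.
by rewrite lee_fin -/p; lra.
Qed.

End NormalBound.

Section RotatedPair.
Context {R : realType} d (T : measurableType d) (P : probability T R).
Variables (I : finType) (g : I -> T -> R).
Hypothesis gP : gaussian_family P g.
Local Notation N01 := (@normal_prob R 0 1).

Lemma measurable_forall_preimage d' (T' : measurableType d') (J : finType) (f : J -> T' -> R)
    (A : J -> set R) : (forall i, measurable_fun setT (f i)) -> (forall i, measurable (A i)) ->
  measurable [set w | forall i, A i (f i w)].
Proof.
move=> mf mA; rewrite (_ : [set w | _] = \bigcap_(i in [set: J]) (f i @^-1` A i)); last first.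
  by apply/seteqP; split => w /= h i //=; exact: h.
apply: fin_bigcap_measurable => // i _.
by rewrite -[X in measurable X]setTI; exact: mf.
Qed.

Lemma gaussian_family_coord2 (i j : I) (f : R * R -> \bar R) : measurable_fun setT f ->
  (forall z, 0 <= f z)%E ->
  (\int[pprod P P]_w f (g i w.1, g j w.2) = \int[N01]_x \int[N01]_y f (x, y))%E.
Proof.
move=> mf f0.
have mfg : measurable_fun setT (fun w : T * T => f (g i w.1, g j w.2)).
  apply: (measurableT_comp mf); apply: measurable_fun_pair;
    by apply: measurableT_comp => //; exact: gP.1.
rewrite (integral_pprod1 P P mfg)//=.
rewrite -(gaussian_family_coord gP i (measurable_integral_snd N01 mf f0)); last first.
  by move=> x; exact: integral_ge0.
apply: eq_integral => w _.
rewrite -(gaussian_family_coord gP j (f := fun y => f (g i w, y)))//.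
by apply: (measurableT_comp mf); exact: measurable_fun_pair.
Qed.

Lemma gaussian_family_pair : gaussian_family (pprod P P)
  (fun (ib : I * bool) w => if ib.2 then g ib.1 w.1 else g ib.1 w.2).
Proof.
split=> [[i b]|A mA] /=.
  by case: b; apply: measurableT_comp => //; exact: gP.1.
rewrite (_ : [set w | _] = [set w | forall i, A (i, true) (g i w)] `*`
   [set w | forall i, A (i, false) (g i w)]); last first.
  apply/seteqP; split => [[w w']/= h|[w w']/= [h h'] [i []]//=].
  by split=> i; [exact: (h (i, true))|exact: (h (i, false))].
rewrite [LHS]pprodE; last 2 first.
- by apply: (measurable_forall_preimage (A := fun i => A (i, true))) => // i; exact: gP.1.
- by apply: (measurable_forall_preimage (A := fun i => A (i, false))) => // i; exact: gP.1.
rewrite (gP.2 (fun i => A (i, true)))// (gP.2 (fun i => A (i, false)))// -big_split /=.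
rewrite (eq_bigr (fun i => \prod_(b : bool) N01 (A (i, b)))%E).
  by rewrite pair_bigA; apply: eq_bigr => -[].
by move=> i _; rewrite big_bool.
Qed.

Let r : R := (Num.sqrt 2)^-1.

Lemma sqr_invsqrt2 : r ^+ 2 = 2^-1.
Proof. by rewrite /r exprVn sqr_sqrtr. Qed.

(** The indicator of a rectangle in the rotated coordinates is a product over [i] of functions of
    the pair of coordinates [i]. The pairs are independent, and [normal01_rotation] with [c = s = r]
    undoes the rotation in each of them. *)
Lemma gaussian_family_rotate : gaussian_family (pprod P P)
  (fun (ib : I * bool) w => if ib.2 then r * g ib.1 w.1 + r * g ib.1 w.2
                            else r * g ib.1 w.2 - r * g ib.1 w.1).
Proof.
have m1 i : measurable_fun setT (fun w : T * T => r * g i w.1).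
  by apply: measurable_funM => //; apply: measurableT_comp => //; exact: gP.1.
have m2 i : measurable_fun setT (fun w : T * T => r * g i w.2).
  by apply: measurable_funM => //; apply: measurableT_comp => //; exact: gP.1.
have mrot (ib : I * bool) : measurable_fun setT
  (fun w : T * T => if ib.2 then r * g ib.1 w.1 + r * g ib.1 w.2
                            else r * g ib.1 w.2 - r * g ib.1 w.1).
  by case: ib.2; [exact: measurable_funD|exact: measurable_funB].
split=> // A mA.
set S := [set w | _].
have mS : measurable S by exact: measurable_forall_preimage.
pose f i (z : R * R) : \bar R := (\1_(A (i, true)) z.1 * \1_(A (i, false)) z.2)%:E.
have f0 i z : (0 <= f i z)%E by rewrite lee_fin mulr_ge0.
have mf i : measurable_fun setT (f i).
  apply/measurable_EFinP; apply: measurable_funM;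
    by apply: measurableT_comp => //; exact: measurable_indic.
pose rot (z : R * R) := (r * z.1 + r * z.2, r * z.2 - r * z.1).
have mrt : measurable_fun setT rot.
  by apply: measurable_fun_pair; [apply: measurable_funD|apply: measurable_funB];
    apply: measurable_funM.
pose phi i (x : fspace R (I * bool)%type) :=
  f i (rot ((x : (I * bool)%type -> R) (i, true), (x : (I * bool)%type -> R) (i, false))).
have mphi i : measurable_fun [set: fspace R (I * bool)%type] (phi i).
  apply: (measurableT_comp (mf i)); apply: (measurableT_comp mrt).
  by apply: measurable_fun_pair; exact: measurable_coord.
rewrite -[X in pprod P P X = _](setIT S) -[LHS]integral_indic//.
transitivity (\int[pprod P P]_w \prod_(i <- index_enum I)
   phi i (fun ib => if ib.2 then g ib.1 w.1 else g ib.1 w.2))%E.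
  apply: eq_integral => w _; rewrite /phi /rot /f /=.
  rewrite indicE; have [wS|wS] := boolP (w \in S).
    rewrite big1// => i _; move: wS; rewrite inE => wS.
    rewrite !indicE (mem_set (wS (i, true))) (mem_set (wS (i, false))).
    by rewrite mulr1.
  have /existsNP[[i b] /= nA] : ~ S w by move=> /mem_set; exact/negP.
  rewrite (bigD1_seq i) ?index_enum_uniq ?mem_index_enum//=.
  rewrite [X in (X%:E * _)%E](_ : _ = 0) ?mul0e//.
  by rewrite !indicE; case: b nA => /= nA; rewrite (memNset nA) ?mulr0 ?mul0r.
rewrite (gaussian_family_block gaussian_family_pair (pi := fst))//; last 3 first.
- exact: index_enum_uniq.
- by move=> *; exact: f0.
- by move=> i x y xy; rewrite /phi !xy.
rewrite (eq_bigr (fun i => \prod_(b : bool) N01 (A (i, b)))%E).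
  by rewrite pair_bigA; apply: eq_bigr => -[].
move=> i _; rewrite big_bool /= /phi /=.
have mfr : measurable_fun setT (fun z => f i (rot z)) by exact: measurableT_comp.
rewrite (gaussian_family_coord2 i i mfr)//.
rewrite (normal01_rotation _ _ (mf i))//; last 2 first.
- by rewrite invr_gt0 sqrtr_gt0.
- by rewrite sqr_invsqrt2; field.
have mi b : measurable_fun setT (fun x => (\1_(A (i, b)) x : R)%:E).
  by apply/measurable_EFinP; exact: measurable_indic.
transitivity (\int[N01]_x ((\1_(A (i, true)) x)%:E * N01 (A (i, false))))%E.
  apply: eq_integral => x _; rewrite /f /=.
  under eq_integral do rewrite EFinM.
  rewrite (ge0_integralZl N01 measurableT (mi false)) ?lee_fin//.
  by rewrite (integral_indicT N01 (mA _)).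
rewrite (ge0_integralZr N01 measurableT (mi true))//.
by rewrite (integral_indicT N01 (mA _)).
Qed.

End RotatedPair.

(** * Quadratic forms *)

(** Serves to restrict the family of all Gaussians to the coordinates of one irrep, or of one of its
    vectors. Indices outside the range of [e] get the side [setT]. *)
Lemma gaussian_family_sub (R : realType) d (T : measurableType d) (P : probability T R)
    (I J : finType) (g : I -> T -> R) (e : J -> I) : injective e ->
  gaussian_family P g -> gaussian_family P (fun j => g (e j)).
Proof.
move=> ie gP; split=> [j|A mA]; first exact: gP.1.
pose B i := if [pick j | e j == i] is Some j then A j else setT.
have BE j : B (e j) = A j.
  rewrite /B; case: pickP => [k /eqP/ie -> //|/(_ j)]; by rewrite eqxx.
have mB i : measurable (B i) by rewrite /B; case: pickP.
have := gaussian_family_marginal gP (mem (codom e)) mB.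
rewrite (_ : [set w | _] = [set w | forall j, A j (g (e j) w)]); last first.
  apply/seteqP; split => w /= h.
    by move=> j; rewrite -BE; apply: h; exact: codom_f.
  by move=> _ /codomP[j ->]; rewrite BE.
move=> ->.
rewrite (eq_bigl (fun i => i \in e @: J)%SET); last first.
  by move=> i; apply/codomP/imsetP => [[j ->]|[j _ ->]]; exists j.
rewrite big_imset /=; last by move=> ? ? _ _; exact: ie.
by apply: eq_big => // j _; rewrite BE.
Qed.

Section QuadraticForm.
Context {R : realType}.
Local Notation N01 := (@normal_prob R 0 1).

Definition bilf (I : finType) (Q : I -> I -> R) (x y : I -> R) : R :=
  \sum_i \sum_j Q i j * x i * y j.

Lemma measurable_bilf d (T : measurableType d) (I : finType) (Q : I -> I -> R)
    (x y : I -> T -> R) : (forall i, measurable_fun setT (x i)) ->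
  (forall i, measurable_fun setT (y i)) ->
  measurable_fun setT (fun w => bilf Q (x ^~ w) (y ^~ w)).
Proof.
move=> mx my; apply: measurable_bigsum => i; apply: measurable_bigsum => j.
by apply: measurable_funM => //; apply: measurable_funM.
Qed.

(** Polarization: by symmetry [Q(x, x) - Q(y, y) = - Q(x + y, y - x)], and the two factors [r]
    contribute [r^2 = 1/2], whence the [- 2]. *)
Lemma bilf_subr_rotate (I : finType) (Q : I -> I -> R) (x y : I -> R) (r : R) :
  (forall i j, Q i j = Q j i) -> r ^+ 2 = 2^-1 ->
  bilf Q x x - bilf Q y y =
  - 2 * bilf Q (fun i => r * x i + r * y i) (fun i => r * y i - r * x i).
Proof.
move=> Qs r2.
have xy : bilf Q x y = bilf Q y x.
  rewrite /bilf exchange_big /=; apply: eq_bigr => i _; apply: eq_bigr => j _.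
  by rewrite Qs; ring.
have -> : bilf Q (fun i => r * x i + r * y i) (fun i => r * y i - r * x i) =
    2^-1 * (bilf Q y y - bilf Q x x + bilf Q x y - bilf Q y x).
  rewrite -r2 /bilf -!sumrB -big_split /= -sumrB mulr_sumr.
  apply: eq_bigr => i _; rewrite -!sumrB -big_split /= -sumrB mulr_sumr.
  by apply: eq_bigr => j _; ring.
by rewrite xy; field.
Qed.

Section Laplace.
Context d (T : measurableType d) (P : probability T R) (I : finType) (g : I -> T -> R).
Hypothesis gP : gaussian_family P g.
Variable Q : I -> I -> R.
Hypothesis Qsym : forall i j, Q i j = Q j i.
Hypothesis Q1 : \sum_i \sum_j Q i j ^+ 2 = 1.
Let z i (y : I -> R) := \sum_j Q i j * y j.

Let bilfE x y : bilf Q x y = \sum_i z i y * x i.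
Proof.
rewrite /bilf; apply: eq_bigr => i _; rewrite /z mulr_suml.
by apply: eq_bigr => j _; ring.
Qed.

(* [(E e^{-|X|})^2 <= E e^{-|X - X'|}] for an independent copy [X'], and
   [X - X' = - 2 B(u, v)] for the rotated, again independent, vectors [u] and [v]. *)
Lemma decouple_quadratic :
  ((\int[P]_w (expR (- `|bilf Q (g ^~ w) (g ^~ w)|))%:E) *
   (\int[P]_w (expR (- `|bilf Q (g ^~ w) (g ^~ w)|))%:E) <=
   \int[P]_w' \int[P]_w (expR (- (2 * `|bilf Q (g ^~ w) (g ^~ w')|)))%:E)%E.
Proof.
pose E w := expR (- `|bilf Q (g ^~ w) (g ^~ w)|).
have mE : measurable_fun setT (fun w => (E w)%:E).
  apply/measurable_EFinP; apply: measurableT_comp => //; apply: measurableT_comp => //.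
  by apply: measurableT_comp => //; apply: measurable_bilf; exact: gP.1.
have E0 w : (0 <= (E w)%:E)%E by rewrite lee_fin expR_ge0.
pose F (x : fspace R (I * bool)%type) : \bar R :=
  (expR (- (2 * `|bilf Q (fun i => (x : (I * bool)%type -> R) (i, true))
     (fun i => (x : (I * bool)%type -> R) (i, false))|)))%:E.
have mF : measurable_fun setT F.
  apply/measurable_EFinP; apply: measurableT_comp => //; apply: measurableT_comp => //.
  apply: measurable_funM => //; apply: measurableT_comp => //.
  by apply: measurable_bilf => i; exact: measurable_coord.
have F0 x : (0 <= F x)%E by rewrite lee_fin expR_ge0.
have rP := gaussian_family_rotate gP; have pP := gaussian_family_pair gP.
have mfr := measurable_comp_family rP.1 mF.
have mfp := measurable_comp_family pP.1 mF.
pose rg (ib : I * bool) (w : T * T) : R :=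
   if ib.2 then (Num.sqrt 2)^-1 * g ib.1 w.1 + (Num.sqrt 2)^-1 * g ib.1 w.2
   else (Num.sqrt 2)^-1 * g ib.1 w.2 - (Num.sqrt 2)^-1 * g ib.1 w.1.
apply: (@le_trans _ _ (\int[pprod P P]_w F (rg ^~ w))%E); last first.
  rewrite (gaussian_family_law rP pP mF F0) integral_pprod2//.
have mE2 : measurable_fun setT (fun w : T * T => (E w.1)%:E * (E w.2)%:E)%E.
  by apply: emeasurable_funM; [apply: (measurableT_comp mE)|apply: (measurableT_comp mE)].
have -> : ((\int[P]_w (E w)%:E) * (\int[P]_w (E w)%:E) =
    \int[pprod P P]_w ((E w.1)%:E * (E w.2)%:E))%E.
  rewrite (integral_pprod1 P P mE2) /=; last by move=> w; rewrite mule_ge0.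
  rewrite -(ge0_integralZr P measurableT mE)//; last exact: integral_ge0.
  by apply: eq_integral => w _; rewrite (ge0_integralZl P measurableT mE).
apply: ge0_le_integral => //.
- by move=> w _; rewrite mule_ge0.
- move=> w _; rewrite /F /E -EFinM lee_fin -expRD ler_expR /= -opprD lerN2.
  have := bilf_subr_rotate (g ^~ w.1) (g ^~ w.2) Qsym (sqr_invsqrt2 (R := R)).
  move=> /(congr1 Num.norm); rewrite normrM normrN normr_nat => <-.
  exact: ler_normB.
Qed.

(** For fixed [w'] the form is linear with coefficients [z i], so it is distributed as [|z| x] with
    [x] normal. With the row norms [Fr i], Cauchy-Schwarz gives [|z| >= sum Fr_i |z_i|]; Jensen with
    the weights [Fr_i^2] then leaves one term per row, in which [z_i / Fr_i] is again standard
    normal. *)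
Lemma decoupled_laplace :
  (\int[P]_w' \int[P]_w (expR (- (2 * `|bilf Q (g ^~ w) (g ^~ w')|)))%:E <=
   \int[N01]_x \int[N01]_y (expR (- (2 * (`|x| * `|y|))))%:E)%E.
Proof.
pose Fr i := Num.sqrt (\sum_j Q i j ^+ 2).
have Fr2 i : Fr i ^+ 2 = \sum_j Q i j ^+ 2.
  by rewrite sqr_sqrtr// sumr_ge0// => j _; exact: sqr_ge0.
have Fr0 i : 0 <= Fr i by exact: sqrtr_ge0.
have w1 : \sum_i Fr i ^+ 2 = 1 by rewrite -Q1; apply: eq_bigr.
have mexp d' (T' : measurableType d') (u : T' -> R) : measurable_fun setT u ->
    measurable_fun setT (fun t => (expR (- u t))%:E).
  by move=> mu_; apply/measurable_EFinP; apply: measurableT_comp => //; exact: measurableT_comp.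
have e0 (u : R) : (0 <= (expR u)%:E)%E by rewrite lee_fin expR_ge0.
have mz i : measurable_fun setT (fun w => z i (g ^~ w)).
  by apply: measurable_bigsum => j; apply: measurable_funM => //; exact: gP.1.
pose G (xw : R * T) i : \bar R := (expR (- (2 * (`|xw.1| * (`|z i (g ^~ xw.2)| / Fr i)))))%:E.
have mG i : measurable_fun setT (G ^~ i).
  apply: mexp; apply: measurable_funM => //; apply: measurable_funM.
    by apply: measurableT_comp.
  apply: measurable_funM => //; apply: measurableT_comp => //.
  exact: (measurableT_comp (mz i)).
have G0 xw i : (0 <= G xw i)%E by exact: e0.
have wG0 xw i : (0 <= (Fr i ^+ 2)%:E * G xw i)%E by rewrite mule_ge0// lee_fin sqr_ge0.
have mwG i : measurable_fun setT (fun xw => (Fr i ^+ 2)%:E * G xw i)%E.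
  exact: emeasurable_funM.
pose H (xw : R * T) : \bar R := (\sum_i (Fr i ^+ 2)%:E * G xw i)%E.
have H0 xw : (0 <= H xw)%E by apply: sume_ge0 => i _.
have mH : measurable_fun setT H by apply: emeasurable_sum.
apply: (@le_trans _ _ (\int[P]_w' \int[N01]_x H (x, w'))%E).
  have mL : measurable_fun setT (fun ww : T * T =>
      (expR (- (2 * `|bilf Q (g ^~ ww.1) (g ^~ ww.2)|)))%:E).
    apply: mexp; apply: measurable_funM => //; apply: measurableT_comp => //.
    by apply: measurable_bilf => i; apply: measurableT_comp => //; exact: gP.1.
  apply: ge0_le_integral => //.
  - by move=> w _; apply: integral_ge0 => *; exact: e0.
  - by apply: (measurable_integral_fst P mL).
  - by apply: (measurable_integral_fst N01 mH).
  move=> w' _.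
  pose f (u : R) : \bar R := (expR (- (2 * `|u|)))%:E.
  have f0 u : (0 <= f u)%E by exact: e0.
  have mf : measurable_fun setT f.
    by apply: mexp; apply: measurable_funM => //; exact: measurableT_comp.
  have -> : (\int[P]_w (expR (- (2 * `|bilf Q (g^~ w) (g^~ w')|)))%:E =
     \int[P]_w f (\sum_i z i (g ^~ w') * g i w)%R)%E.
    by apply: eq_integral => w _; rewrite bilfE.
  rewrite (gaussian_family_lin gP (fun i => z i (g ^~ w')) mf)//.
  apply: ge0_le_integral => //.
  - by apply: (measurableT_comp mf); exact: measurable_funM.
  - by apply: (measurableT_comp mH); exact: measurable_fun_pair.
  move=> x _; rewrite /f /H /G /=.
  under [X in (_ <= X)%E]eq_bigr do rewrite -EFinM.
  rewrite sumEFin lee_fin.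
  apply: le_trans (expR_jensen (fun i => 2 * (`|x| * (`|z i (g^~ w')| / Fr i)))
    (fun i => sqr_ge0 (Fr i)) w1).
  rewrite ler_expR lerN2 normrM ger0_norm ?sqrtr_ge0//.
  have -> : \sum_i Fr i ^+ 2 * (2 * (`|x| * (`|z i (g^~ w')| / Fr i))) =
     2 * (`|x| * \sum_i Fr i * `|z i (g^~ w')|).
    rewrite !mulr_sumr; apply: eq_bigr => i _.
    (* A vanishing row has weight zero, so the division by [Fr i] is harmless there. *)
    have [->|Fi] := eqVneq (Fr i) 0; first by ring.
    by field.
  rewrite ler_pM2l// [leLHS]mulrC; apply: ler_wpM2r => //.
  rewrite -(@ler_pXn2r _ 2) ?nnegrE ?sqrtr_ge0//; last first.
    by apply: sumr_ge0 => i _; rewrite mulr_ge0.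
  apply: le_trans (sum_mul_le _ _) _; rewrite w1 mul1r sqr_sqrtr.
    by apply: ler_sum => i _; rewrite real_normK ?num_real.
  by apply: sumr_ge0 => i _; exact: sqr_ge0.
rewrite -(integral_pprod2 N01 P mH)// (integral_pprod1 N01 P mH)//.
have mk : measurable_fun setT (fun x : R => \int[N01]_y (expR (- (2 * (`|x| * `|y|))))%:E)%E.
  apply: (measurable_integral_snd N01
    (f := fun z : R * R => (expR (- (2 * (`|z.1| * `|z.2|))))%:E)) => //.
  by apply: mexp; apply: measurable_funM => //; apply: measurable_funM; exact: measurableT_comp.
apply: ge0_le_integral => //.
- by move=> x _; apply: integral_ge0.
- by apply: (measurable_integral_snd P mH).
move=> x _; rewrite /H.
have mwGx i : measurable_fun setT (fun w => (Fr i ^+ 2)%:E * G (x, w) i)%E.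
  by apply: (measurableT_comp (mwG i)); exact: measurable_fun_pair.
rewrite (ge0_integral_sum P measurableT mwGx)//.
set K := (\int[N01]_y _)%E.
have K0 : (0 <= K)%E by apply: integral_ge0.
apply: (@le_trans _ _ (\sum_i (Fr i ^+ 2)%:E * K)%E); last first.
  by rewrite -ge0_sume_distrl => [|i _]; rewrite ?sumEFin ?w1 ?mul1e// lee_fin sqr_ge0.
apply: lee_sum => i _.
have mGx : measurable_fun setT (fun w => G (x, w) i).
  by apply: (measurableT_comp (mG i)); exact: measurable_fun_pair.
rewrite (ge0_integralZl P measurableT mGx) ?lee_fin ?sqr_ge0//.
have [Fi|Fi] := eqVneq (Fr i) 0; first by rewrite Fi expr0n !mul0e.
rewrite lee_pmul2l// ?lte_fin ?exprn_gt0 ?lt_neqAle ?Fr0 ?andbT ?(eq_sym 0)//.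
pose f (u : R) : \bar R := (expR (- (2 * (`|x| * (`|u| / Fr i)))))%:E.
have f0 u : (0 <= f u)%E by exact: e0.
have mf : measurable_fun setT f.
  apply: mexp; apply: measurable_funM => //; apply: measurable_funM => //.
  by apply: measurable_funM => //; exact: measurableT_comp.
rewrite (gaussian_family_lin gP (fun j => Q i j) mf)// -/(Fr i) le_eqVlt.
apply/orP; left; apply/eqP.
apply: eq_integral => y _; rewrite /f normrM (ger0_norm (Fr0 i)).
by congr (expR (- (2 * (_ * _))))%:E; field.
Qed.

End Laplace.

Lemma quadratic_laplace : exists2 q : R, 0 < q < 1 &
  forall d (T : measurableType d) (P : probability T R) (I : finType) (g : I -> T -> R)
    (Q : I -> I -> R), gaussian_family P g -> (forall i j, Q i j = Q j i) ->
    \sum_i \sum_j Q i j ^+ 2 = 1 ->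
    (\int[P]_w (expR (- `|bilf Q (g ^~ w) (g ^~ w)|))%:E <= q%:E)%E.
Proof.
have [k /andP[k0 k1] kP] := @normal01_product_laplace R.
(* [(1 + k) / 2] in place of [k] keeps [q] positive even if [k = 0], so that [ln q] can serve as a
   rate; [k < 1] gives both [k <= q^2] and [q < 1]. *)
pose q := Num.sqrt ((1 + k) / 2).
have q2 : q ^+ 2 = (1 + k) / 2 by rewrite sqr_sqrtr//; lra.
have q0 : 0 < q by rewrite sqrtr_gt0; lra.
exists q; first by rewrite q0 /= -(@ltr_pXn2r _ 2) ?nnegrE ?ltW// q2 expr1n; lra.
move=> d T P I g Q gP Qs Q1.
have := le_trans (decouple_quadratic gP Qs) (le_trans (decoupled_laplace gP Q1) kP).
set X := (\int[P]_w _)%E.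
have X0 : (0 <= X)%E by apply: integral_ge0 => *; rewrite lee_fin expR_ge0.
case: X X0 => [x| |]; [|by rewrite mulyy leye_eq|by rewrite leNgt ltNye].
rewrite !lee_fin => x0 xk.
by rewrite -(@ler_pXn2r _ 2) ?nnegrE ?(ltW q0)// q2 expr2; lra.
Qed.

(** Markov's inequality for [e^(- sum |X_t|)], whose expectation is at most [q^#|K|] by independence
    of the blocks [t]. With [c = - ln q / 2] this is [e^(- 2 c #|K|)], and the threshold costs a
    factor [e^(c #|K|)]. *)
Lemma quadratic_lower_tail : exists2 c : R, 0 < c &
  forall d (T : measurableType d) (P : probability T R) (K J : finType)
    (g : K * J -> T -> R) (Q : J -> J -> R), gaussian_family P g ->
    (forall i j, Q i j = Q j i) -> \sum_i \sum_j Q i j ^+ 2 = 1 ->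
    (P [set w | \sum_t `|bilf Q (fun j => g (t, j) w) (fun j => g (t, j) w)| < c * #|K|%:R]%R
      <= (expR (- (c * #|K|%:R)))%:E)%E.
Proof.
have [q /andP[q0 q1] qP] := quadratic_laplace.
exists (- ln q / 2); first by rewrite divr_gt0// oppr_gt0 ln_lt0// q0.
move=> d T P K J g Q gP Qs Q1; set c := - ln q / 2.
pose X t w := bilf Q (fun j => g (t, j) w) (fun j => g (t, j) w).
have mX t : measurable_fun setT (X t) by apply: measurable_bilf => i; exact: gP.1.
set S := [set w | _].
have mS : measurable S.
  have mf : measurable_fun setT (fun w => \sum_t `|X t w|).
    by apply: measurable_bigsum => t; exact: measurableT_comp.
  have := mf measurableT _ (measurable_itv `]-oo, c * #|K|%:R[).
  rewrite setTI; congr measurable; apply/seteqP; split => w /=; by rewrite in_itv.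
rewrite -integral_indicT//.
pose phi t (x : fspace R (K * J)%type) : \bar R :=
  (expR (- `|bilf Q (fun j => (x : (K * J)%type -> R) (t, j))
    (fun j => (x : (K * J)%type -> R) (t, j))|))%:E.
have mphi t : measurable_fun setT (phi t).
  apply/measurable_EFinP; apply: measurableT_comp => //; apply: measurableT_comp => //.
  by apply: measurableT_comp => //; apply: measurable_bilf => i; exact: measurable_coord.
have phi0 t x : (0 <= phi t x)%E by rewrite lee_fin expR_ge0.
have pE w : (\prod_(t <- index_enum K) phi t (fun i => g i w) = (expR (- \sum_t `|X t w|))%:E)%E.
  rewrite -sumrN expR_sum.
  by elim/big_rec2 : _ => // t a b _ ->; rewrite -EFinM.
have mp : measurable_fun setT (fun w => \prod_(t <- index_enum K) phi t (fun i => g i w))%E.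
  under eq_fun do rewrite pE.
  apply/measurable_EFinP; apply: measurableT_comp => //; apply: measurableT_comp => //.
  by apply: measurable_bigsum => t; exact: measurableT_comp.
apply: (@le_trans _ _ ((expR (c * #|K|%:R))%:E *
  \int[P]_w \prod_(t <- index_enum K) phi t (fun i => g i w))%E).
  rewrite -(ge0_integralZl P measurableT mp) ?lee_fin ?expR_ge0//; last first.
    by move=> w _; rewrite pE lee_fin expR_ge0.
  apply: ge0_le_integral => //.
  - by apply/measurable_EFinP; exact: measurable_indic.
  - exact: emeasurable_funM.
  - move=> w _; rewrite pE -EFinM lee_fin -expRD indicE.
    have [|_] := boolP (w \in S); last by rewrite expR_ge0.
    by rewrite inE /S /= => /ltW h; rewrite -[leLHS]expR0 ler_expR subr_ge0.
rewrite (gaussian_family_block gP (pi := fst))//; last 2 first.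
- exact: index_enum_uniq.
- by move=> t x y xy; rewrite /phi; under eq_fun do rewrite xy//.
have -> : expR (- (c * #|K|%:R)) = expR (c * #|K|%:R) * q ^+ #|K|.
  rewrite -[X in _ * X ^+ _](@lnK _ q) ?posrE// -expRM_natr -expRD; congr expR.
  by rewrite /c; field.
rewrite EFinM lee_wpmul2l ?lee_fin ?expR_ge0//.
have -> : (q ^+ #|K|)%:E = (\prod_(t <- index_enum K) q%:E)%E.
  by rewrite prodEFin prodr_const.
have key t : (\int[P]_w phi t (g ^~ w) <= q%:E)%E.
  apply: (qP _ _ _ _ (fun j => g (t, j))) => //.
  by apply: gaussian_family_sub gP => j j' [].
suff /andP[] : (0 <= \prod_(t <- index_enum K) \int[P]_w phi t (g ^~ w))%E &&
  (\prod_(t <- index_enum K) \int[P]_w phi t (g ^~ w) <=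
   \prod_(t <- index_enum K) q%:E)%E by [].
apply: (big_rec2 (fun a b => (0 <= a)%E && (a <= b)%E)); first by rewrite lee01 lexx.
have I0 t : (0 <= \int[P]_w phi t (g ^~ w))%E by apply: integral_ge0.
by move=> t a b _ /andP[a0 ab]; rewrite mule_ge0//= lee_pmul.
Qed.

End QuadraticForm.

(** * Norm of a Gaussian matrix *)

Section BilinearNet.
Context {R : realType}.

Lemma sum_geometric2_le (N : nat) : \sum_(k < N) (2^-1 : R) ^+ k <= 2.
Proof.
have -> : \sum_(k < N) (2^-1 : R) ^+ k = 2 * (1 - 2^-1 ^+ N).
  elim: N => [|N IH]; first by rewrite big_ord0 expr0 subrr mulr0.
  by rewrite big_ord_recr /= IH exprS; field.
have : 0 <= (2^-1 : R) ^+ N by apply: exprn_ge0; lra.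
lra.
Qed.

Section Grid.
Variables (n : nat) (n0 : (0 < n)%N).
Local Notation cell := (bool * 'I_(4 * n).+1)%type.

(** Chosen so that an error of at most [mesh] in each of [n] coordinates moves a vector by at most
    [1/4]. *)
Definition mesh : R := (4 * Num.sqrt n%:R)^-1.
(** A sign and a number of mesh steps; a coordinate of a unit-ball vector has at most
    [4 sqrt n <= 4 n] steps. Zero has two encodings, which can only enlarge the count of the
    grid. *)
Definition cellv (c : cell) : R := (if c.1 then -1 else 1) * (c.2 : nat)%:R * mesh.
Definition in_grid (I : finType) (z : {ffun I -> cell}) : bool :=
  \sum_i cellv (z i) ^+ 2 <= 1.

Lemma sqrtn_gt0 : 0 < Num.sqrt n%:R :> R.
Proof. by rewrite sqrtr_gt0 ltr0n. Qed.

Lemma mesh_gt0 : 0 < mesh.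
Proof. by rewrite invr_gt0 mulr_gt0 ?sqrtn_gt0. Qed.

Lemma mesh_sq : mesh ^+ 2 = (16 * n%:R)^-1.
Proof.
rewrite /mesh exprVn exprMn sqr_sqrtr ?ler0n//; congr (_ * _)^-1; ring.
Qed.

Lemma cellv_sq (c : cell) : cellv c ^+ 2 = (c.2 : nat)%:R ^+ 2 * mesh ^+ 2.
Proof. by rewrite /cellv !exprMn; case: c.1; rewrite ?sqrrN ?expr1n mul1r. Qed.

(* Rounding towards [0] keeps the rounded vectors inside the unit ball. *)
Lemma cell_round (a : R) : `|a| <= 1 ->
  exists2 c : cell, cellv c ^+ 2 <= a ^+ 2 & (a - cellv c) ^+ 2 <= mesh ^+ 2.
Proof.
move=> a1; have m0 := mesh_gt0.
have := truncn_itv (divr_ge0 (normr_ge0 a) (ltW m0)).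
set k := Num.truncn _ => /andP[k1 k2].
have kle : (k < (4 * n).+1)%N.
  rewrite ltnS -(ler_nat R); apply: le_trans k1 _.
  rewrite /mesh invrK natrM; apply: (@le_trans _ _ (1 * (4 * Num.sqrt n%:R))).
    by rewrite ler_wpM2r// mulr_ge0// sqrtr_ge0.
  rewrite mul1r ler_pM2l// -[leRHS]sqr_sqrtr ?ler0n// expr2.
  rewrite -[leLHS]mulr1 ler_pM2l ?sqrtn_gt0//.
  by rewrite -(@ler_pXn2r _ 2) ?nnegrE ?sqrtr_ge0// sqr_sqrtr ?ler0n// expr1n ler1n.
have {}k1 : k%:R * mesh <= `|a| by rewrite -ler_pdivlMr.
have {}k2 : `|a| < k%:R * mesh + mesh.
  by rewrite ltr_pdivrMr// -addn1 natrD mulrDl mul1r in k2.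
have k0 : 0 <= k%:R * mesh by rewrite mulr_ge0// ltW.
exists (a < 0, Ordinal kle); rewrite /cellv /=.
  rewrite -[leRHS]real_normK ?num_real//.
  by case: (a < 0); nra.
by have [a0|a0] := ltP a 0; [rewrite ltr0_norm// in k1 k2|rewrite ger0_norm// in k1 k2]; nra.
Qed.

Lemma grid_round (I : finType) (p : I -> R) : #|I| = n -> \sum_i p i ^+ 2 <= 1 ->
  exists2 z : {ffun I -> cell}, in_grid z &
    \sum_i (p i - cellv (z i)) ^+ 2 <= 4^-1 ^+ 2.
Proof.
move=> cI p1.
have pi1 i : `|p i| <= 1.
  rewrite -(@ler_pXn2r _ 2) ?nnegrE// expr1n real_normK ?num_real//.
  apply: le_trans p1; rewrite (bigD1 i)//= lerDl sumr_ge0// => j _; exact: sqr_ge0.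
have /(_ _)/cid2 h i := cell_round (pi1 i).
exists [ffun i => s2val (h i)].
  apply: le_trans p1; apply: ler_sum => i _; rewrite ffunE; exact: (s2valP (h i)).
apply: (@le_trans _ _ (\sum_(i : I) mesh ^+ 2)).
  by apply: ler_sum => i _; rewrite ffunE; exact: (s2valP' (h i)).
rewrite sumr_const cI mesh_sq -mulr_natl le_eqVlt; apply/orP; left; apply/eqP.
by field; rewrite pnatr_eq0 -lt0n.
Qed.

(* The absolute values [k_i] of the integer coordinates of a grid vector satisfy
   [\sum k_i <= \sum k_i ^ 2 <= 16 n], so that a grid vector has weight at least [2 ^ (- 16 n)] for
   the weight [2 ^ (- \sum k_i)], whose total mass factorizes over the coordinates. *)
Lemma card_grid (I : finType) : #|I| = n ->
  #|[set z : {ffun I -> cell} | in_grid z]%SET|%:R <= 2 ^+ (18 * n) :> R.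
Proof.
move=> cI.
have gk (z : {ffun I -> cell}) : in_grid z -> (\sum_i (z i).2 <= 16 * n)%N.
  rewrite /in_grid => zg.
  have : \sum_i ((z i).2 : nat)%:R ^+ 2 <= 16 * n%:R :> R.
    move: zg; under eq_bigr do rewrite cellv_sq.
    rewrite -mulr_suml mesh_sq => zg.
    by rewrite -[leRHS]mul1r -ler_pdivrMr// mulr_gt0// ltr0n.
  rewrite -(ler_nat R) natrM; apply: le_trans; rewrite natr_sum.
  apply: ler_sum => i _; case: (nat_of_ord (z i).2) => [|k]; first by rewrite expr0n.
  by rewrite expr2 -[leLHS]mulr1 ler_wpM2l// ler1n.
have wE (z : {ffun I -> cell}) : \prod_i (2^-1 : R) ^+ (z i).2 = 2^-1 ^+ (\sum_i (z i).2).
  by rewrite prodrXr.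
have h0 : 0 < (2^-1 : R) by lra.
apply: (@le_trans _ _ (2 ^+ (16 * n) * \sum_(z : {ffun I -> cell}) \prod_i (2^-1 : R) ^+ (z i).2)).
  rewrite -sum1_card natr_sum mulr_sumr.
  rewrite [leRHS](bigID (fun z => z \in [set z : {ffun I -> cell} | in_grid z]%SET))/=.
  rewrite -[leLHS]addr0; apply: lerD; last first.
    apply: sumr_ge0 => z _; rewrite mulr_ge0 ?exprn_ge0//.
    by apply: prodr_ge0 => i _; rewrite exprn_ge0// ltW.
  apply: ler_sum => z; rewrite finset.inE => /gk zk.
  rewrite wE -(subnK zk) exprD -mulrA exprVn divff ?expf_neq0// mulr1.
  by apply: exprn_ege1; rewrite ler1n.
rewrite -(bigA_distr_bigA (fun (i : I) (c : cell) => (2^-1 : R) ^+ c.2)) /=.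
(* Two signs, each with a geometric sum of at most 2: every coordinate contributes [2^2], which
   raises the exponent [16 n] to [18 n]. *)
have sE : \sum_(c : cell) (2^-1 : R) ^+ c.2 <= 2 ^+ 2.
  rewrite -(pair_bigA _ (fun (b : bool) (k : 'I_(4 * n).+1) => (2^-1 : R) ^+ k)) /= big_bool /=.
  by have := sum_geometric2_le (4 * n).+1; lra.
rewrite (_ : 2 ^+ (18 * n) = 2 ^+ (16 * n) * \prod_(i : I) (2 ^+ 2 : R)); last first.
  by rewrite prodr_const cI -exprM -exprD; congr (_ ^+ _); rewrite -mulnDl.
rewrite ler_pM2l ?exprn_gt0//; apply: ler_prod => i _; rewrite sE andbT.
by apply: sumr_ge0 => c _; rewrite exprn_ge0// ltW.
Qed.

Section NetToSup.
Variables (L I : finType) (M : L -> I -> R).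
Hypotheses (cL : #|L| = n) (cI : #|I| = n).
Let beta (v : L -> R) (u : I -> R) : R := \sum_t \sum_i M t i * (v t * u i).
Variable k : R.
Hypothesis netk : forall (y : {ffun L -> cell}) (z : {ffun I -> cell}),
  in_grid y -> in_grid z -> beta (fun t => cellv (y t)) (fun i => cellv (z i)) <= k.

Let betaZ a b v u : beta (fun t => a * v t) (fun i => b * u i) = a * b * beta v u.
Proof.
rewrite /beta mulr_sumr; apply: eq_bigr => t _; rewrite mulr_sumr.
by apply: eq_bigr => i _; ring.
Qed.

(* The supremum [s] of the form on the unit balls satisfies [s <= k + s / 4 + s / 4]. *)
Lemma net_bilinear_le v u : \sum_t v t ^+ 2 <= 1 -> \sum_i u i ^+ 2 <= 1 -> beta v u <= 2 * k.
Proof.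
pose E := [set x | exists v u, [/\ \sum_t v t ^+ 2 <= 1, \sum_i u i ^+ 2 <= 1 & x = beta v u]].
have E0 : E !=set0.
  exists (beta (fun=> 0) (fun=> 0)), (fun=> 0), (fun=> 0); split=> //;
    by rewrite big1// => *; rewrite expr0n.
have le1 (J : finType) (p : J -> R) : \sum_i p i ^+ 2 <= 1 -> forall i, `|p i| <= 1.
  move=> p1 i; rewrite -(@ler_pXn2r _ 2) ?nnegrE// expr1n real_normK ?num_real//.
  apply: le_trans p1; rewrite (bigD1 i)//= lerDl sumr_ge0// => j _; exact: sqr_ge0.
have Eub : has_ubound E.
  exists (\sum_t \sum_i `|M t i|) => _ [v' [u' [v1 u1 ->]]].
  apply: ler_sum => t _; apply: ler_sum => i _.
  apply: le_trans (ler_norm _) _; rewrite normrM -[leRHS]mulr1 ler_wpM2l//.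
  by rewrite normrM mulr_ile1//; exact: le1.
have Esup : has_sup E by split.
have supE v' u' : \sum_t v' t ^+ 2 <= 1 -> \sum_i u' i ^+ 2 <= 1 -> beta v' u' <= sup E.
  by move=> v1 u1; apply: (sup_upper_bound Esup); exists v', u'.
have sc (J : finType) (p : J -> R) : \sum_i p i ^+ 2 <= 4^-1 ^+ 2 -> \sum_i (4 * p i) ^+ 2 <= 1.
  move=> p4; under eq_bigr do rewrite exprMn.
  by rewrite -mulr_sumr; lra.
suff S2k : sup E <= 2 * k by move=> v1 u1; apply: le_trans (supE _ _ v1 u1) S2k.
suff : sup E <= k + sup E / 2 by lra.
apply: ge_sup => // _ [v' [u' [v1 u1 ->]]].
have [y yg yr] := grid_round cL v1; have [z zg zr] := grid_round cI u1.
pose y' t := cellv (y t); pose z' i := cellv (z i).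
(* The rounding errors have norm at most [1/4]; multiplied by 4 they are back in the unit balls,
   where the supremum applies to them. *)
have -> : beta v' u' = beta y' z' + 4^-1 * beta (fun t => 4 * (v' t - y' t)) u'
    + 4^-1 * beta y' (fun i => 4 * (u' i - z' i)).
  rewrite /beta !mulr_sumr -!big_split /=; apply: eq_bigr => t _.
  rewrite !mulr_sumr -!big_split /=; apply: eq_bigr => i _; by field.
have b1 := netk yg zg.
have b2 := supE _ _ (sc _ _ yr) u1.
have b3 := supE _ _ yg (sc _ _ zr).
by move: b1 b2 b3; rewrite -/y' -/z'; lra.
Qed.

(** The form is tested on [M u / |M u|] and [u / |u|], where it takes the value [|M u| / |u|];
    vanishing norms are dealt with first. *)
Lemma net_operator_le u : \sum_t (\sum_i M t i * u i) ^+ 2 <= (2 * k) ^+ 2 * \sum_i u i ^+ 2.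
Proof.
set A := \sum_t _; set B := \sum_i _.
have A0 : 0 <= A by apply: sumr_ge0 => t _; exact: sqr_ge0.
have B0 : 0 <= B by apply: sumr_ge0 => t _; exact: sqr_ge0.
have [B00|Bn0] := eqVneq B 0.
  have u0 i : u i = 0.
    apply/eqP; rewrite -sqrf_eq0; apply/eqP.
    by apply: (psumr_eq0P (P := predT) (F := fun i => u i ^+ 2)) => // j _; exact: sqr_ge0.
  rewrite B00 mulr0 /A big1// => t _; rewrite big1 ?expr0n// => i _.
  by rewrite u0 mulr0.
have [->|An0] := eqVneq A 0; first by rewrite mulr_ge0// sqr_ge0.
have {Bn0}B0 : 0 < B by rewrite lt_neqAle eq_sym Bn0.
have {An0}A0 : 0 < A by rewrite lt_neqAle eq_sym An0.
set a := Num.sqrt A; set b := Num.sqrt B.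
have a2 : a ^+ 2 = A by rewrite sqr_sqrtr// ltW.
have b2 : b ^+ 2 = B by rewrite sqr_sqrtr// ltW.
have a0 : 0 < a by rewrite sqrtr_gt0.
have b0 : 0 < b by rewrite sqrtr_gt0.
pose q t := \sum_i M t i * u i.
have h := @net_bilinear_le (fun t => a^-1 * q t) (fun i => b^-1 * u i).
have {h} : a ^-1 * b^-1 * A <= 2 * k.
  rewrite (_ : A = beta q u); last first.
    apply: eq_bigr => t _; rewrite expr2 mulr_sumr -/(q t); apply: eq_bigr => i _; ring.
  rewrite -betaZ; apply: h.
    under eq_bigr do rewrite exprMn.
    by rewrite -mulr_sumr -/A -a2 exprVn mulVf// expf_neq0// gt_eqF.
  under eq_bigr do rewrite exprMn.
  by rewrite -mulr_sumr -/B -b2 exprVn mulVf// expf_neq0// gt_eqF.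
rewrite -a2 (_ : a^-1 * b^-1 * a ^+ 2 = a / b); last by field; rewrite !gt_eqF.
rewrite ler_pdivrMr// => h; rewrite -b2 -exprMn lerXn2r// nnegrE ?ltW//.
exact: lt_le_trans h.
Qed.

End NetToSup.
End Grid.
End BilinearNet.

(** * Tail bounds for linear forms and for Gaussian matrices *)

Section MatrixTail.
Context {R : realType} d (T : measurableType d) (P : probability T R).

Lemma measure_bigsetU_le (J : Type) (s : seq J) (A : J -> set T) :
  (forall j, measurable (A j)) ->
  (P (\big[setU/set0]_(j <- s) A j) <= \sum_(j <- s) P (A j))%E.
Proof.
move=> mA; elim: s => [|j s IH]; first by rewrite !big_nil measure0.
rewrite !big_cons; apply: le_trans (measureU2 _ _ _) _ => //.
  by apply: bigsetU_measurable.
exact: leeD2l.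
Qed.

(** Chernoff's bound with parameter [k]: if [sg^2 <= 1] is the variance, then [e^(- k^2) e^(k^2 sg^2
    / 2) <= e^(- k^2 / 2)]. *)
Lemma gaussian_linear_tail (I : finType) (g : I -> T -> R) (c : I -> R) (k : R) :
  gaussian_family P g -> \sum_i c i ^+ 2 <= 1 -> 0 <= k ->
  (P [set w | k < \sum_i c i * g i w]%R <= (expR (- (k ^+ 2 / 2)))%:E)%E.
Proof.
move=> gP c1 k0.
pose L w := \sum_i c i * g i w.
have mL : measurable_fun setT L.
  by apply: measurable_bigsum => i; apply: measurable_funM => //; exact: gP.1.
set S := [set w | _].
have mS : measurable S.
  have := mL measurableT _ (measurable_itv `]k, +oo[).
  rewrite setTI; congr measurable; apply/seteqP; split => w /=; by rewrite in_itv /= andbT.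
rewrite -integral_indicT//.
pose f (u : R) : \bar R := (expR (k * u))%:E.
have mf : measurable_fun setT f.
  by apply/measurable_EFinP; apply: measurableT_comp => //; exact: measurable_funM.
have f0 u : (0 <= f u)%E by rewrite lee_fin expR_ge0.
have mfL := measurableT_comp mf mL.
apply: (@le_trans _ _ ((expR (- k ^+ 2))%:E * \int[P]_w f (L w))%E).
  rewrite -(ge0_integralZl P measurableT mfL) ?lee_fin ?expR_ge0//; last first.
    by move=> w _; exact: f0.
  apply: ge0_le_integral => //.
  - by apply/measurable_EFinP; exact: measurable_indic.
  - exact: emeasurable_funM.
  - move=> w _; rewrite /f /= -EFinM lee_fin -expRD indicE.
    have [|_] := boolP (w \in S); last by rewrite expR_ge0.
    rewrite inE /S /= -/(L w) => h; rewrite -[leLHS]expR0 ler_expR.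
    by rewrite expr2 -mulrN -mulrDr mulr_ge0//; lra.
set sg := Num.sqrt (\sum_i c i ^+ 2).
have -> : (\int[P]_w f (L w) = \int[normal_prob 0 1]_x f (sg * x)%R)%E.
  by have e := gaussian_family_lin gP c mf f0; refine e.
have sg1 : sg ^+ 2 <= 1 by rewrite sqr_sqrtr// sumr_ge0// => i _; exact: sqr_ge0.
have -> : (\int[normal_prob 0 1]_x f (sg * x)%R = (expR ((k * sg) ^+ 2 / 2))%:E)%E.
  by rewrite -normal01_mgf; apply: eq_integral => x _; rewrite /f mulrA.
rewrite -EFinM lee_fin -expRD ler_expR exprMn.
have := ler_wpM2l (sqr_ge0 k) sg1; lra.
Qed.

Lemma gaussian_matrix_tail (L I : finType) (n : nat) (g : L * I -> T -> R) :
  (0 < n)%N -> #|L| = n -> #|I| = n -> gaussian_family P g ->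
  exists B : set T, [/\ measurable B, (P B <= (expR (- (14 * n%:R)))%:E)%E &
    forall w, ~ B w -> forall u : I -> R,
      \sum_t (\sum_i g (t, i) w * u i) ^+ 2 <= 400 * n%:R * \sum_i u i ^+ 2].
Proof.
move=> n0 cL cI gP.
(* Each grid pair fails with probability at most [e^(- k^2 / 2) = e^(- 50 n)], and there are at most
   [2^(36 n) <= e^(36 n)] pairs; this leaves [e^(- 14 n)]. The operator bound is
   [(2 k)^2 = 400 n]. *)
pose k : R := 10 * Num.sqrt n%:R.
have k2 : k ^+ 2 = 100 * n%:R by rewrite /k exprMn sqr_sqrtr ?ler0n//; congr (_ * _); ring.
have k0 : 0 <= k by rewrite mulr_ge0// sqrtr_ge0.
pose X := ({ffun L -> bool * 'I_(4 * n).+1} * {ffun I -> bool * 'I_(4 * n).+1})%type.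
pose c (x : X) (ti : L * I) : R := cellv (R := R) (x.1 ti.1) * cellv (R := R) (x.2 ti.2).
pose good (x : X) := in_grid (R := R) x.1 && in_grid (R := R) x.2.
pose A (x : X) : set T := if good x then [set w | k < \sum_ti c x ti * g ti w] else set0.
have mA x : measurable (A x).
  rewrite /A; case: ifP => // _.
  have mL : measurable_fun setT (fun w => \sum_ti c x ti * g ti w).
    by apply: measurable_bigsum => i; apply: measurable_funM => //; exact: gP.1.
  have := mL measurableT _ (measurable_itv `]k, +oo[).
  rewrite setTI; congr measurable; apply/seteqP; split => w /=; by rewrite in_itv /= andbT.
exists (\big[setU/set0]_(x <- index_enum X) A x); split.
- by apply: bigsetU_measurable.
- apply: le_trans (measure_bigsetU_le _ mA) _.
  apply: (@le_trans _ _ (\sum_(x : X) (if good x then (expR (- (50 * n%:R)))%:E else 0))%E).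
    apply: lee_sum => x _; rewrite /A; case: ifPn => [/andP[g1 g2]|_]; last by rewrite measure0.
    rewrite (_ : 50 * n%:R = k ^+ 2 / 2); last by rewrite k2; field.
    apply: gaussian_linear_tail => //.
    rewrite -(pair_bigA _ (fun t i => c x (t, i) ^+ 2)) /=.
    rewrite (eq_bigr (fun t => cellv (R := R) (x.1 t) ^+ 2 *
        \sum_i cellv (R := R) (x.2 i) ^+ 2)); last first.
      by move=> t _; rewrite mulr_sumr; apply: eq_bigr => i _; rewrite /c exprMn.
    rewrite -mulr_suml mulr_ile1//; by apply: sumr_ge0 => *; exact: sqr_ge0.
  rewrite -big_mkcond /= sumEFin lee_fin sumr_const.
  have -> : #|good| = (#|[set z : {ffun L -> bool * 'I_(4 * n).+1} | in_grid (R := R) z]%SET| *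
      #|[set z : {ffun I -> bool * 'I_(4 * n).+1} | in_grid (R := R) z]%SET|)%N.
    by rewrite -cardsX; apply: eq_card => -[y z]; rewrite finset.inE /= !finset.inE.
  rewrite -[leLHS]mulr_natl natrM.
  apply: (@le_trans _ _ (2 ^+ (18 * n) * 2 ^+ (18 * n) * expR (- (50 * n%:R)))).
    by rewrite ler_wpM2r ?expR_ge0// ler_pM// card_grid.
  apply: (@le_trans _ _ (expR 1 ^+ (18 * n) * expR 1 ^+ (18 * n) * expR (- (50 * n%:R)))).
    have e2 : 2 <= expR 1 :> R by have := @expR_ge1Dx R 1; lra.
    rewrite ler_wpM2r ?expR_ge0// ler_pM ?exprn_ge0//;
      by apply: lerXn2r => //; rewrite nnegrE ?expR_ge0.
  rewrite -!expRM_natl -!expRD ler_expR mulr1 natrM.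
  have : 0 <= n%:R :> R by []. lra.
move=> w nB u.
have nA x : ~ A x w.
  move=> Ax; apply: nB; rewrite -bigcup_seq; exists x => //=.
  exact: mem_index_enum.
rewrite (_ : 400 * n%:R = (2 * k) ^+ 2); last by rewrite exprMn k2; ring.
apply: (net_operator_le n0 cL cI) => y z yg zg.
have := nA (y, z); rewrite /A /good yg zg /= => /negP; rewrite -leNgt.
apply: le_trans; rewrite le_eqVlt; apply/orP; left; apply/eqP.
by rewrite pair_bigA /=; apply: eq_bigr => -[t i] _ /=; rewrite mulrC.
Qed.

End MatrixTail.

(** * Irreducible representations and coset states *)

Section Representations.
Variables (R : realType) (gT : finGroupType) (S : irrep_system R gT).
Local Notation C := (R[i]).

Let G : {group gT} := [set: gT]%G.

Lemma irdim_gt0 (r : 'I_(nirr S)) : (0 < irdim r)%N.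
Proof. by have /mx_irrP[] := irrep_irreducible r. Qed.

Lemma complex_splitting (H : {group gT}) : group_splitting_field C H.
Proof. exact: group_closure_closed_field. Qed.

(** Pairwise inequivalent irreps inject into the irreducible components of the regular
    representation, which are as many as the conjugacy classes. The union bound runs over this many
    terms. *)
Lemma nirr_le_card : (nirr S <= #|gT|)%N.
Proof.
have cG : ([pchar C]^'.-group G)%g.
  by apply/pgroupP => p _ _; rewrite inE /= pchar_num.
apply: (@socle_exists _ _ G _ (regular_repr C G)) => sG.
have inj : injective (fun r => irr_comp sG (@irrep _ _ S r)).
  move=> r s rs; apply: irrep_inequiv.
  apply: mx_rsim_trans (rsim_irr_comp_pchar sG cG (irrep_irreducible r)) _.
  rewrite rs; apply: mx_rsim_sym.
  exact: (rsim_irr_comp_pchar sG cG (irrep_irreducible s)).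
have := leq_card _ inj; rewrite card_ord => /leq_trans; apply.
rewrite (card_irr_pchar sG cG (@complex_splitting G)).
by apply: leq_trans (leq_imset_card _ _) _; rewrite cardsT.
Qed.

Section OneIrrep.
Variable r : 'I_(nirr S).
Local Notation d := (irdim r).
Local Notation rho := (@irrep _ _ S r).

Lemma irrepM x y : rho (x * y)%g = rho x *m rho y.
Proof. by rewrite repr_mxM ?inE. Qed.

Lemma irrepV x : rho x^-1%g = ctrmx (rho x).
Proof.
have u := irrep_unitary r x.
have v : rho x^-1%g *m rho x = 1%:M by rewrite -irrepM mulVg repr_mx1.
by rewrite -[LHS]mulmx1 -u mulmxA v mul1mx.
Qed.

Lemma irrep_conjE x i j : conjc (rho x i j) = rho x^-1%g j i.
Proof. by rewrite irrepV !mxE. Qed.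

(** The sum of [rho x *m E *m rho x^-1] with [E] a matrix unit commutes with the representation, so
    Schur's lemma makes it scalar, and its trace determines the scalar. The claim is the entry
    [(i, k)]. *)
Lemma schur_orthogonality i j k l :
  \sum_x rho x i j * conjc (rho x k l) =
  (#|gT|%:R / d%:R) * ((i == k) && (j == l))%:R.
Proof.
pose E : 'M[C]_d := delta_mx j l.
pose M := \sum_x rho x *m E *m rho x^-1%g.
have ME y : M *m rho y = rho y *m M.
  rewrite mulmx_suml mulmx_sumr (reindex_inj (mulgI y)) /=; apply: eq_bigr => x _.
  by rewrite irrepM invMg irrepM -!mulmxA -irrepM mulVg repr_mx1 mulmx1.
have : is_scalar_mx M.
  apply: (mx_abs_irr_cent_scalar (complex_splitting (irrep_irreducible r))).
  by apply/centgmxP => y _; rewrite ME.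
move=> /is_scalar_mxP[a aM].
have d0 : d%:R != 0 :> C by rewrite pnatr_eq0 -lt0n irdim_gt0.
have trE : \tr E = (j == l)%:R.
  rewrite /mxtrace (bigD1 j)//= mxE eqxx /= big1 ?addr0 ?(eq_sym l)//.
  by move=> u uj; rewrite mxE (negbTE uj).
have trM : \tr M = #|gT|%:R * (j == l)%:R.
  rewrite /M raddf_sum /= (eq_bigr (fun=> (j == l)%:R)).
    by rewrite sumr_const mulr_natl.
  by move=> x _; rewrite mxtrace_mulC mulmxA -irrepM mulVg repr_mx1 mul1mx trE.
have aE : a = #|gT|%:R / d%:R * (j == l)%:R.
  by rewrite mulrAC -trM aM mxtrace_scalar -[a *+ _]mulr_natr mulfK.
transitivity (M i k).
  rewrite summxE; apply: eq_bigr => x _; rewrite irrep_conjE -mulmxA mxE (bigD1 j)//=.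
  rewrite big1 ?addr0 => [|u uj].
    congr (_ * _); rewrite mxE (bigD1 l)//= mxE !eqxx mul1r big1 ?addr0// => u ul.
    by rewrite mxE (negbTE ul) andbF mul0r.
  by rewrite mxE big1 ?mulr0// => v _; rewrite mxE (negbTE uj) mul0r.
rewrite aM mxE aE -mulrnAr; congr (_ * _).
by case: (i == k); case: (j == l).
Qed.

Definition hsum (H : {group gT}) : 'M[C]_d := #|H|%:R *: rhoH r H.

Lemma card_neq0 (H : {group gT}) : #|H|%:R != 0 :> C.
Proof. by rewrite pnatr_eq0 -lt0n cardG_gt0. Qed.

Lemma hsumE (H : {group gT}) : hsum H = \sum_(h in H) rho h.
Proof. by rewrite /hsum /rhoH scalerA divff ?card_neq0// scale1r. Qed.

Lemma hsum_herm (H : {group gT}) i j : conjc (hsum H i j) = hsum H j i.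
Proof.
rewrite !hsumE !summxE rmorph_sum /= (reindex_inj invg_inj) /=.
by apply: eq_big => [h|h _]; rewrite ?groupV// irrep_conjE invgK.
Qed.

(** [rhoH r H] is idempotent; in its full-rank factorization [col_base Q *m row_base Q] the reversed
    product is therefore the identity of size [\rank Q], and the trace is cyclic. *)
Lemma trace_hsum (H : {group gT}) : \tr (hsum H) = (#|H| * \rank (rhoH r H))%:R.
Proof.
rewrite /hsum mxtraceZ natrM; congr (_ * _).
set Q := rhoH r H.
have QQ : Q *m Q = Q.
  rewrite {1}/Q /rhoH -scalemxAl mulmx_suml (eq_bigr (fun=> Q)).
    by rewrite sumr_const -[Q *+ _]scaler_nat scalerA mulVf ?card_neq0// scale1r.
  move=> h hH; rewrite /Q /rhoH -scalemxAr mulmx_sumr; congr (_ *: _).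
  rewrite [RHS](reindex_inj (mulgI h)) /=.
  by apply: eq_big => [x|x _]; rewrite ?groupMl// irrepM.
have [L LC] := row_fullP (col_base_full Q).
have [M RM] := row_freeP (row_base_free Q).
have QE := mulmx_base Q.
have gen k (A : 'M[C]_(d, k)) (B : 'M[C]_(k, d)) (A1 : 'M[C]_(k, d)) (B1 : 'M[C]_(d, k)) :
    A1 *m A = 1%:M -> B *m B1 = 1%:M -> A *m B *m (A *m B) = A *m B -> B *m A = 1%:M.
  move=> A1A BB1 /(congr1 (fun X => A1 *m X *m B1)).
  by rewrite !mulmxA A1A !mul1mx -!mulmxA BB1 mulmx1.
have rc : row_base Q *m col_base Q = 1%:M by apply: gen LC RM _; rewrite QE.
transitivity (\tr (col_base Q *m row_base Q)); first by rewrite QE.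
by rewrite mxtrace_mulC rc mxtrace1.
Qed.

Lemma coset_stateE (H : {group gT}) a b :
  coset_state R H a b = (a^-1 * b \in H)%g%:R / #|gT|%:R.
Proof.
rewrite /coset_state.
have -> : \sum_(g : gT) ((a \in lcoset H g) && (b \in lcoset H g))%:R =
    (a^-1 * b \in H)%g%:R * #|H|%:R :> C.
  rewrite -(card_lcoset H a) -sum1_card natr_sum mulr_sumr [RHS]big_mkcond /=.
  apply: eq_bigr => g _.
  have -> : (a \in lcoset H g) = (a^-1 * g \in H)%g.
    by rewrite lcosetE mem_lcoset -groupV invMg invgK.
  rewrite lcosetE !mem_lcoset; have [agH|//] := boolP (a^-1 * g \in H)%g.
  have -> : (a^-1 * b = (a^-1 * g) * (g^-1 * b))%g by rewrite -mulgA mulKVg.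
  by rewrite (groupMl _ agH) mulr1.
by rewrite natrM -mulf_div divff ?card_neq0// mulr1.
Qed.

(** Substituting [b = a h] with [h] in [H] and expanding [rho (a * h)] leaves sums over [a] that
    Schur orthogonality evaluates; only the inner index [j] survives. The result is the same for
    every row [i]. *)
Lemma fstateE (H : {group gT}) i j j' :
  fstate H (@Tagged _ r (@fidx_fam R gT S) (i, j)) (@Tagged _ r (@fidx_fam R gT S) (i, j')) =
  conjc (hsum H j j') / #|gT|%:R.
Proof.
have g0 : #|gT|%:R != 0 :> C by rewrite -cardsT card_neq0.
have d0 : d%:R != 0 :> C by rewrite pnatr_eq0 -lt0n irdim_gt0.
have sq : toC (Num.sqrt (d%:R / #|gT|%:R)) * conjc (toC (Num.sqrt (d%:R / #|gT|%:R))) =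
    d%:R / #|gT|%:R :> C.
  have -> : d%:R / #|gT|%:R = (d%:R / #|gT|%:R : R)%:C%C.
    by rewrite rmorphM fmorphV !rmorph_nat.
  rewrite -[X in _ = X%:C%C]sqr_sqrtr ?divr_ge0 ?ler0n//; set x := Num.sqrt _.
  by apply/eqP; rewrite eq_complex /=; apply/andP; split; apply/eqP; ring.
rewrite /fstate /qft /=.
transitivity (\sum_a \sum_(h in H) d%:R / #|gT|%:R / #|gT|%:R *
    (rho a i j * conjc (rho (a * h)%g i j'))).
  apply: eq_bigr => a _; rewrite (reindex_inj (mulgI a)) /= [RHS]big_mkcond /=.
  apply: eq_bigr => h _; rewrite coset_stateE mulKg -sq rmorphM.
  case: (h \in H); last by rewrite mul0r mulr0 mul0r.
  by rewrite mul1r; ring.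
transitivity (\sum_(h in H) \sum_m d%:R / #|gT|%:R / #|gT|%:R * (conjc (rho h m j') *
    \sum_a (rho a i j * conjc (rho a i m)))).
  rewrite exchange_big /=; apply: eq_bigr => h _.
  transitivity (\sum_a \sum_m d%:R / #|gT|%:R / #|gT|%:R * (conjc (rho h m j') *
    (rho a i j * conjc (rho a i m)))).
    apply: eq_bigr => a _; rewrite irrepM mxE rmorph_sum /= !mulr_sumr.
    by apply: eq_bigr => m _; rewrite rmorphM; ring.
  by rewrite exchange_big /=; apply: eq_bigr => m _; rewrite !mulr_sumr.
rewrite hsumE summxE rmorph_sum /= mulr_suml; apply: eq_bigr => h _.
rewrite (bigD1 j)//= schur_orthogonality !eqxx big1 ?addr0 => [|m mj].
  by rewrite mulr1; field; rewrite g0 d0.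
by rewrite schur_orthogonality eq_sym (negbTE mj) andbF !mulr0.
Qed.

End OneIrrep.
End Representations.

(** * Gram operators *)

Section ComplexNorms.
Context {R : realType}.
Local Notation C := (R[i]).

Lemma cabs_ge_Re (z : C) : `|complex.Re z| <= cabs z.
Proof.
rewrite /cabs -sqrtr_sqr; apply: ler_wsqrtr.
by rewrite /cnorm2 lerDl sqr_ge0.
Qed.

Lemma Re_sum (I : Type) (s : seq I) (F : I -> C) :
  complex.Re (\sum_(i <- s) F i) = \sum_(i <- s) complex.Re (F i).
Proof. by elim/big_rec2 : _ => // i x [a b] _ <-; case: (F i). Qed.

Lemma Im_sum (I : Type) (s : seq I) (F : I -> C) :
  complex.Im (\sum_(i <- s) F i) = \sum_(i <- s) complex.Im (F i).
Proof. by elim/big_rec2 : _ => // i x [a b] _ <-; case: (F i). Qed.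

Lemma sum_cabs_ge_Re (I : Type) (s : seq I) (F : I -> C) :
  `|complex.Re (\sum_(i <- s) F i)| <= \sum_(i <- s) cabs (F i).
Proof.
rewrite Re_sum; apply: le_trans (ler_norm_sum _ _ _) _.
by apply: ler_sum => i _; exact: cabs_ge_Re.
Qed.

Lemma cnorm2_ge0 (z : C) : 0 <= cnorm2 z.
Proof. by rewrite addr_ge0 ?sqr_ge0. Qed.

Lemma cnorm2_eq0 (z : C) : cnorm2 z = 0 -> z = 0.
Proof.
case: z => a b /eqP; rewrite /cnorm2 /= paddr_eq0 ?sqr_ge0// !sqrf_eq0.
by move=> /andP[/eqP-> /eqP->].
Qed.

Lemma vnorm_sq (I : finType) (v : I -> C) : vnorm v ^+ 2 = \sum_i cnorm2 (v i).
Proof. by rewrite sqr_sqrtr// sumr_ge0// => i _; exact: cnorm2_ge0. Qed.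

Lemma vnorm_ge0 (I : finType) (v : I -> C) : 0 <= vnorm v.
Proof. exact: sqrtr_ge0. Qed.

Lemma Re_divr (z : C) (x : R) : complex.Re (z / toC x) = complex.Re z / x.
Proof.
have [->|x0] := eqVneq x 0; first by rewrite (_ : toC 0 = 0)// !invr0 !mulr0.
by case: z => a b; rewrite /= expr0n /= addr0; field.
Qed.

Section GramOperator.
Variables (L I : finType) (b : L -> I -> C) (s : R).
Let M (u v : I) : C := \sum_t b t u * conjc (b t v).
Let form (v : I -> C) (t : L) : C := \sum_u conjc (b t u) * v u.
Hypothesis s0 : 0 <= s.
Hypothesis bRe : forall p : I -> R,
  \sum_t (\sum_u complex.Re (b t u) * p u) ^+ 2 <= s * \sum_u p u ^+ 2.
Hypothesis bIm : forall p : I -> R,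
  \sum_t (\sum_u complex.Im (b t u) * p u) ^+ 2 <= s * \sum_u p u ^+ 2.

(** Splitting into real and imaginary parts gives sums of two real terms;
    [(a + b)^2 <= 2 (a^2 + b^2)] costs a factor 2, and each of [p], [q] is met by both the real and
    the imaginary matrix, which costs another. *)
Lemma form_le v : \sum_t cnorm2 (form v t) <= 4 * s * \sum_u cnorm2 (v u).
Proof.
pose p u := complex.Re (v u); pose q u := complex.Im (v u).
pose X w t := \sum_u complex.Re (b t u) * w u.
pose Y w t := \sum_u complex.Im (b t u) * w u.
have fE t : cnorm2 (form v t) = (X p t + Y q t) ^+ 2 + (X q t - Y p t) ^+ 2.
  rewrite /cnorm2 /form Re_sum Im_sum /X /Y -big_split /= -sumrB.
  by congr (_ ^+ 2 + _ ^+ 2); apply: eq_bigr => u _; rewrite /p /q;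
    case: (b t u) => x y; case: (v u) => z w /=; ring.
apply: (@le_trans _ _ (2 * (\sum_t X p t ^+ 2 + \sum_t Y q t ^+ 2 +
   \sum_t X q t ^+ 2 + \sum_t Y p t ^+ 2))).
  rewrite -!big_split /= mulr_sumr; apply: ler_sum => t _; rewrite fE.
  have := sqr_ge0 (X p t - Y q t); have := sqr_ge0 (X q t + Y p t); rewrite !expr2; lra.
have := bRe p; have := bRe q; have := bIm p; have := bIm q.
have -> : \sum_u cnorm2 (v u) = \sum_u p u ^+ 2 + \sum_u q u ^+ 2 by rewrite -big_split.
rewrite -/(X p) -/(X q) -/(Y p) -/(Y q) /X /Y; lra.
Qed.

(* With [y = M v], [|y|^2 = <form v, form y>]; Cauchy-Schwarz and [form_le] give
   [|y|^2 <= 4 s |v| |y|]. *)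
Lemma gram_vnorm_le v : vnorm (fun i => \sum_j M i j * v j) <= 4 * s * vnorm v.
Proof.
set y := fun i => _.
have yE u : y u = \sum_t b t u * form v t.
  rewrite /y /M /form; under eq_bigr do rewrite mulr_suml.
  rewrite exchange_big /=; apply: eq_bigr => t _; rewrite mulr_sumr.
  by apply: eq_bigr => w _; rewrite mulrA.
have key : \sum_u cnorm2 (y u) = \sum_(tb : L * bool)
   (if tb.2 then complex.Re (form v tb.1) else complex.Im (form v tb.1)) *
   (if tb.2 then complex.Re (form y tb.1) else complex.Im (form y tb.1)).
  rewrite -(pair_bigA _ (fun t (c : bool) =>
    (if c then complex.Re (form v t) else complex.Im (form v t)) *
    (if c then complex.Re (form y t) else complex.Im (form y t)))) /=.
  transitivity (\sum_t complex.Re (form v t * conjc (form y t))); last first.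
    apply: eq_bigr => t _; rewrite big_bool /=.
    by case: (form v t) => a c; case: (form y t) => e f /=; ring.
  transitivity (complex.Re (\sum_u y u * conjc (y u))).
    rewrite Re_sum; apply: eq_bigr => u _; rewrite /cnorm2.
    by case: (y u) => a c /=; ring.
  rewrite -Re_sum; congr complex.Re.
  transitivity (\sum_u \sum_t b t u * form v t * conjc (y u)).
    by apply: eq_bigr => u _; rewrite {1}yE mulr_suml.
  rewrite exchange_big /=; apply: eq_bigr => t _.
  rewrite {2}/form rmorph_sum mulr_sumr; apply: eq_bigr => u _.
  by rewrite rmorphM /= conjcK mulrCA mulrA.
have pairE (f : L -> C) : \sum_(tb : L * bool)
    (if tb.2 then complex.Re (f tb.1) else complex.Im (f tb.1)) ^+ 2 = \sum_t cnorm2 (f t).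
  rewrite -(pair_bigA _ (fun t (c : bool) =>
    (if c then complex.Re (f t) else complex.Im (f t)) ^+ 2)) /=.
  by apply: eq_bigr => t _; rewrite big_bool.
have := sum_mul_le (fun tb : L * bool => if tb.2 then complex.Re (form v tb.1)
    else complex.Im (form v tb.1)) (fun tb : L * bool =>
    if tb.2 then complex.Re (form y tb.1) else complex.Im (form y tb.1)).
rewrite -key !pairE -!vnorm_sq => h.
have fv := form_le v; have fy := form_le y; rewrite -!vnorm_sq in fv fy.
have y0 := vnorm_ge0 y; have v0 := vnorm_ge0 v.
have sv0 : 0 <= 4 * s * vnorm v by rewrite !mulr_ge0.
have [->//|yn0] := eqVneq (vnorm y) 0.
have {yn0}y0 : 0 < vnorm y by rewrite lt_neqAle eq_sym yn0.
rewrite -(@ler_pXn2r _ 2) ?nnegrE ?(ltW y0)//.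
have y20 : 0 < vnorm y ^+ 2 by rewrite exprn_gt0.
rewrite -(ler_pM2r y20) -expr2; apply: le_trans h _.
have -> : (4 * s * vnorm v) ^+ 2 * vnorm y ^+ 2 =
  (4 * s * vnorm v ^+ 2) * (4 * s * vnorm y ^+ 2) by ring.
by apply: ler_pM => //; exact: sqr_ge0.
Qed.

Lemma opnorm_gram_le : opnorm M <= 4 * s.
Proof.
apply: ge_sup.
  by exists (vnorm (fun i => \sum_j M i j * (fun=> 0) j)), (fun=> 0) => //=;
    rewrite /vnorm big1 ?sqrtr0// => i _; rewrite /cnorm2 /= expr0n addr0.
move=> _ [v /= v1 <-]; apply: le_trans (gram_vnorm_le v) _.
by rewrite -[leRHS]mulr1 ler_wpM2l// mulr_ge0.
Qed.

(** The left-hand side is the diagonal entry [M u u], a coordinate of the image of a basis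
    vector. *)
Lemma opnorm_gram_ge u : \sum_t cnorm2 (b t u) <= opnorm M.
Proof.
pose e : I -> C := fun i => (i == u)%:R.
have e1 : vnorm e <= 1.
  rewrite /vnorm (bigD1 u)//= big1 => [|i iu].
    by rewrite /e eqxx /cnorm2 /= expr0n expr1n !addr0 sqrtr1.
  by rewrite /e (negbTE iu) /cnorm2 /= expr0n addr0.
apply: (@le_trans _ _ (vnorm (fun i => \sum_j M i j * e j))); last first.
  apply: sup_upper_bound; last by exists e.
  (* [sup] dominates only sets that are bounded above, so the bound [4 * s] is needed here as
     well. *)
  split; first by exists (vnorm (fun i => \sum_j M i j * e j)), e.
  exists (4 * s) => _ [v /= v1 <-]; apply: le_trans (gram_vnorm_le v) _.
  by rewrite -[leRHS]mulr1 ler_wpM2l// mulr_ge0.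
have Mu : \sum_j M u j * e j = M u u.
  rewrite (bigD1 u)//= big1 ?addr0 ?{1}/e ?eqxx ?mulr1// => i iu.
  by rewrite /e (negbTE iu) mulr0.
have -> : \sum_t cnorm2 (b t u) = complex.Re (M u u).
  rewrite Re_sum; apply: eq_bigr => t _; rewrite /cnorm2.
  by case: (b t u) => x y /=; ring.
apply: le_trans (ler_norm _) _; rewrite -Mu.
apply: le_trans (cabs_ge_Re _) _; apply: ler_wsqrtr.
by rewrite [leRHS](bigD1 u)//= lerDl sumr_ge0// => i _; exact: cnorm2_ge0.
Qed.

End GramOperator.
End ComplexNorms.

(** * Outcome statistics for one irreducible representation *)

Lemma big_option (R : Type) (idx : R) (op : Monoid.com_law idx) (I : finType)
    (F : option I -> R) :
  \big[op/idx]_(o : option I) F o = op (F None) (\big[op/idx]_(i : I) F (Some i)).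
Proof.
rewrite (bigD1 None)//=; congr (op _ _).
rewrite (reindex_omap Some id) /=; last by case.
by apply: eq_bigl => i; rewrite eqxx.
Qed.

Section Outcomes.
Variables (R : realType) (gT : finGroupType) (S : irrep_system R gT).
Variables (Cst : R) (x : gidx S Cst -> R) (H1 H2 : {group gT}).
Local Notation C := (R[i]).
Variable r : 'I_(nirr S).
Local Notation d := (irdim r).
Local Notation m := (mdim Cst r).
Local Notation K := (Kdim Cst r).
Hypothesis K0 : (0 < K)%N.
Let k0 : 'I_K := Ordinal K0.

Definition hdiff : 'M[C]_d := hsum r H1 - hsum r H2.
Definition outcome_diff (i : 'I_d) (o : option 'I_m) : C :=
  povm_prob x H1 (@Tagged _ r (@outc_fam R gT S Cst) (i, o)) -
  povm_prob x H2 (@Tagged _ r (@outc_fam R gT S Cst) (i, o)).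

Lemma hdiffE a b : hdiff a b = hsum r H1 a b - hsum r H2 a b.
Proof. by rewrite /hdiff [LHS]mxE [X in _ + X]mxE. Qed.

Lemma hdiff_herm a b : conjc (hdiff a b) = hdiff b a.
Proof.
by rewrite (hdiffE a) (hdiffE b) (rmorphB (@conjc R)); congr (_ - _); exact: hsum_herm.
Qed.

(** The complex conjugation in [fstateE] transposes the Hermitian [hsum], which cancels the
    transposition in the trace. The right-hand side does not mention the row [i]. *)
Lemma outcome_diffE i o :
  outcome_diff i o = (\sum_a \sum_b hdiff a b * povmF x o a b) / #|gT|%:R.
Proof.
have pE (H : {group gT}) : povm_prob x H (@Tagged _ r (@outc_fam R gT S Cst) (i, o)) =
    (\sum_a \sum_b hsum r H a b * povmF x o a b) / #|gT|%:R.
  rewrite /povm_prob /= exchange_big /= mulr_suml; apply: eq_bigr => a _.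
  rewrite mulr_suml; apply: eq_bigr => b _.
  by rewrite fstateE hsum_herm mulrAC.
rewrite /outcome_diff !pE -mulrBl -sumrB; congr (_ / _); apply: eq_bigr => a _.
by rewrite -sumrB; apply: eq_bigr => b _; rewrite hdiffE mulrBl.
Qed.

Lemma povmFE (o : option 'I_m) (a b : 'I_d) : povmF x o a b = povmE x o (a, k0) (b, k0).
Proof. by rewrite /povmF (big_pred1 k0)// => k; rewrite -val_eqE. Qed.

(** The residual element compensates the others exactly, whatever the value of [ell], so this holds
    for every realization. *)
Lemma sum_povmF (a b : 'I_d) : \sum_(o : option 'I_m) povmF x o a b = (a == b)%:R.
Proof.
under eq_bigr do rewrite povmFE.
rewrite big_option /= xpair_eqE eqxx andbT -mulr_suml -/(bsum x (a, k0) (b, k0)).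
by rewrite subrK.
Qed.

Lemma card_gT_toC : #|gT|%:R = toC #|gT|%:R :> C.
Proof. by rewrite -(rmorph_nat (@real_complex_def R (Phant R))). Qed.

(** Completeness of the POVM makes the differences over all outcomes add up to [\tr hdiff / #|gT|],
    and [trace_hsum] identifies the traces with the ranks in [PH]. *)
Lemma trace_le_outcomes i :
  `|PH H1 r - PH H2 r| <= d%:R * \sum_o cabs (outcome_diff i o).
Proof.
apply: (@le_trans _ _ (d%:R * `|complex.Re (\sum_o outcome_diff i o)|)); last first.
  by rewrite ler_wpM2l ?ler0n// sum_cabs_ge_Re.
have -> : \sum_o outcome_diff i o = \tr hdiff / #|gT|%:R.
  under eq_bigr do rewrite outcome_diffE.
  rewrite -mulr_suml; congr (_ / _); rewrite exchange_big /=; apply: eq_bigr => a _.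
  rewrite exchange_big /=; under eq_bigr do rewrite -mulr_sumr sum_povmF.
  rewrite (bigD1 a)//= eqxx mulr1 big1 ?addr0// => b ba.
  by rewrite eq_sym (negbTE ba) mulr0.
have Renat (n : nat) : complex.Re (n%:R : C) = n%:R.
  by rewrite -(rmorph_nat (@real_complex_def R (Phant R))).
have ReB (z1 z2 : C) : complex.Re (z1 - z2) = complex.Re z1 - complex.Re z2.
  by case: z1; case: z2.
have -> : \tr hdiff = \tr (hsum r H1) - \tr (hsum r H2).
  exact: (raddfB (@mxtrace C d)).
rewrite card_gT_toC Re_divr ReB (trace_hsum r H1) (trace_hsum r H2) (Renat (_ * _)%N).
rewrite (Renat (#|H2| * _)%N).
have -> : PH H1 r - PH H2 r = d%:R *
    (((#|H1| * \rank (rhoH r H1))%:R - (#|H2| * \rank (rhoH r H2))%:R) / #|gT|%:R).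
  by rewrite /PH -!mulnA !(natrM _ d) -mulrBl -mulrBr mulrA.
by rewrite normrM (ger0_norm (ler0n _ _)).
Qed.

(* The matrix of the real part of [\sum_(a, b) hdiff a b * z_a * z_b^*] in the coordinates
   [Re z_a] (index [(a, true)]) and [Im z_a] (index [(a, false)]). *)
Definition qform (u v : 'I_d * bool) : R :=
  if u.2 == v.2 then complex.Re (hdiff u.1 v.1)
  else if u.2 then complex.Im (hdiff u.1 v.1) else - complex.Im (hdiff u.1 v.1).

Lemma qform_sym u v : qform u v = qform v u.
Proof.
case: u v => [a s] [b t]; rewrite /qform /= (eq_sym t) -(hdiff_herm b a).
by case: (hdiff b a) => p q /=; case: s; case: t => //=; rewrite ?opprK.
Qed.

Lemma sum_bool_pair (F : 'I_d * bool -> R) :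
  \sum_u F u = \sum_a (F (a, true) + F (a, false)).
Proof.
transitivity (\sum_a \sum_(s : bool) F (a, s)).
  by rewrite pair_bigA; apply: eq_bigr => -[].
by apply: eq_bigr => a _; rewrite big_bool.
Qed.

(** Each complex entry occurs as a real 2 by 2 block that contains its real and its imaginary part
    twice; this is why [qform] is normalized by [Num.sqrt 2 * frob hdiff]. *)
Lemma sum_qform_sq : \sum_u \sum_v qform u v ^+ 2 = 2 * frob hdiff ^+ 2.
Proof.
have -> : frob hdiff ^+ 2 = \sum_a \sum_b cnorm2 (hdiff a b).
  rewrite sqr_sqrtr// sumr_ge0// => a _; rewrite sumr_ge0// => b _; exact: cnorm2_ge0.
rewrite sum_bool_pair mulr_sumr; apply: eq_bigr => a _.
rewrite !sum_bool_pair -big_split mulr_sumr /=; apply: eq_bigr => b _.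
by rewrite /qform /cnorm2 /=; ring.
Qed.

Definition realcoord (t : 'I_m) (u : 'I_d * bool) : R :=
  x (@Tagged _ r (@gfam R gT S Cst) (t, u.1, k0, u.2)).

Lemma Re_outcome_diff i t :
  complex.Re (outcome_diff i (Some t)) =
  bilf qform (realcoord t) (realcoord t) / ell x r / #|gT|%:R.
Proof.
rewrite outcome_diffE card_gT_toC Re_divr; congr (_ / _).
transitivity (complex.Re ((\sum_a \sum_b hdiff a b *
   (bvec x t a k0 * conjc (bvec x t b k0))) / toC (ell x r))).
  congr complex.Re; rewrite mulr_suml; apply: eq_bigr => a _; rewrite mulr_suml.
  by apply: eq_bigr => b _; rewrite povmFE /= mulrA.
rewrite Re_divr; congr (_ / _); rewrite Re_sum /bilf sum_bool_pair.
apply: eq_bigr => a _; rewrite Re_sum !sum_bool_pair -big_split /=.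
apply: eq_bigr => b _; rewrite /qform /realcoord /bvec /=.
by case: (hdiff a b) => p q /=; ring.
Qed.

(** * The deterministic estimate for a good realization *)

Section Bound.
Variable c : R.
Hypothesis c0 : 0 < c.
Hypothesis F0 : 0 < frob hdiff.
Hypothesis quadP : c * m%:R <= \sum_t
  `|bilf (fun u v => qform u v / (Num.sqrt 2 * frob hdiff)) (realcoord t) (realcoord t)|.
Hypothesis reP : forall p : 'I_d * 'I_K -> R,
  \sum_(t : 'I_m) (\sum_u x (@Tagged _ r (@gfam R gT S Cst) (t, u.1, u.2, true)) * p u) ^+ 2
    <= 400 * m%:R * \sum_u p u ^+ 2.
Hypothesis imP : forall p : 'I_d * 'I_K -> R,
  \sum_(t : 'I_m) (\sum_u x (@Tagged _ r (@gfam R gT S Cst) (t, u.1, u.2, false)) * p u) ^+ 2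
    <= 400 * m%:R * \sum_u p u ^+ 2.

Let b (t : 'I_m) (u : 'I_d * 'I_K) : C := bvec x t u.1 u.2.

Lemma m_gt0 : (0 < m)%N.
Proof. by rewrite muln_gt0 K0 irdim_gt0. Qed.

Let s400 : 0 <= 400 * m%:R :> R.
Proof. exact: mulr_ge0 (ler0n _ _) (ler0n _ _). Qed.

Lemma ell_le : ell x r <= 4 * (400 * m%:R).
Proof. exact: (@opnorm_gram_le _ _ _ b _ s400 reP imP). Qed.

(** Otherwise [opnorm_gram_ge] would make all vectors [b t] vanish, and with them the quadratic
    forms that [quadP] bounds from below. *)
Lemma ell_gt0 : 0 < ell x r.
Proof.
rewrite ltNge; apply/negP => l0.
have b0 t u : b t u = 0.
  have h : \sum_t cnorm2 (b t u) <= 0.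
    exact: le_trans (@opnorm_gram_ge _ _ _ b _ s400 reP imP u) l0.
  have e : cnorm2 (b t u) = 0.
    apply: (psumr_eq0P (P := predT) (F := fun t => cnorm2 (b t u))) => //.
      by move=> t' _; exact: cnorm2_ge0.
    by apply/eqP; rewrite eq_le h sumr_ge0// => t' _; exact: cnorm2_ge0.
  exact: cnorm2_eq0.
have x0 t u : realcoord t u = 0.
  have := b0 t (u.1, k0); rewrite /b /bvec /realcoord /= => -[e1 e2].
  by case: u.2.
have := quadP; rewrite big1 => [|t _].
  by rewrite leNgt mulr_gt0// ltr0n m_gt0.
by rewrite /bilf big1 ?normr0// => u _; rewrite big1// => v _; rewrite x0 mulr0 mul0r.
Qed.

(** The forms add up to at least [c m sqrt 2] times the Frobenius norm, while
    [ell <= 4 * 400 * m = 1600 m]; the factor [sqrt 2 >= 1] is dropped, and so is the residual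
    outcome. *)
Lemma frob_le_outcomes i :
  c / 1600 * (frob hdiff / #|gT|%:R) <= \sum_o cabs (outcome_diff i o).
Proof.
have g0 : 0 < #|gT|%:R :> R by rewrite ltr0n -cardsT cardG_gt0.
have s20 : 0 < Num.sqrt 2 :> R by rewrite sqrtr_gt0.
have s21 : 1 <= Num.sqrt 2 :> R.
  by rewrite -[leLHS]sqrtr1; apply: ler_wsqrtr; rewrite ler1n.
have l0 := ell_gt0.
have m0 : 0 < m%:R :> R by rewrite ltr0n m_gt0.
rewrite big_option /=; apply: (@le_trans _ _ (\sum_t cabs (outcome_diff i (Some t)))); last first.
  by rewrite lerDr sqrtr_ge0.
pose B t := bilf qform (realcoord t) (realcoord t).
apply: (@le_trans _ _ ((\sum_t `|B t|) / ell x r / #|gT|%:R)); last first.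
  rewrite -mulrA mulr_suml; apply: ler_sum => t _.
  apply: le_trans (cabs_ge_Re _); rewrite Re_outcome_diff -/(B t) -mulrA normrM.
  by rewrite [X in _ <= _ * X]ger0_norm// divr_ge0// ?invr_ge0 ?ltW.
rewrite [leLHS]mulrA ler_pM2r ?invr_gt0// ler_pdivlMr//.
have quad' : c * m%:R * (Num.sqrt 2 * frob hdiff) <= \sum_t `|B t|.
  rewrite -ler_pdivlMr ?mulr_gt0//; apply: le_trans quadP _.
  rewrite le_eqVlt mulr_suml; apply/orP; left; apply/eqP; apply: eq_bigr => t _.
  rewrite -[X in _ = _ / X]ger0_norm ?mulr_ge0 ?ltW// -normf_div; congr (`|_|).
  rewrite /B /bilf mulr_suml; apply: eq_bigr => u _; rewrite mulr_suml.
  by apply: eq_bigr => v _; ring.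
apply: le_trans quad'.
apply: (@le_trans _ _ (c / 1600 * frob hdiff * (4 * (400 * m%:R)))).
  by rewrite ler_pM2l; [exact: ell_le|rewrite mulr_gt0 ?divr_gt0 ?ltr0n].
have -> : 4 * (400 * m%:R) = 1600 * m%:R :> R by rewrite mulrA -natrM.
have aux (q y z : R) : q != 0 -> c / q * y * (q * z) = c * z * (1 * y) by move=> q0; field.
by rewrite aux ?pnatr_eq0// ler_pM2l ?mulr_gt0// ler_pM2r.
Qed.

End Bound.
End Outcomes.

(** * The union bound *)

Lemma iid_gaussian_family (R : realType) d (T : measurableType d) (P : probability T R)
    (I : finType) (g : I -> T -> R) : iid_std_gaussian P g -> gaussian_family P g.
Proof.
move=> [mg [Ng Pg]]; split=> // A mA.
rewrite (_ : [set w | _] = \bigcap_(i in [set: I]) (g i @^-1` A i)); last first.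
  by apply/seteqP; split => w /= h i //=; exact: h.
by rewrite Pg//; apply: eq_bigr => i _; exact: Ng.
Qed.

(** Reduces to [ln 2 >= 1/2], which is [ln (1 + y) <= y] at [y = - 1/2]. *)
Lemma ln_ge_half (R : realType) (n : nat) : (1 < n)%N -> 2^-1 <= ln n%:R :> R.
Proof.
move=> n1; apply: (@le_trans _ _ (ln 2)); last first.
  by rewrite ler_ln ?posrE ?ltr0n ?ler_nat// (leq_trans _ n1).
have := @le_ln1Dx R (- 2^-1); rewrite (_ : 1 - 2^-1 = 2^-1); last by field.
by rewrite lnV ?posrE// => h; have := h ltac:(lra); lra.
Qed.

Section Assembly.
Variables (R : realType) (gT : finGroupType) (S : irrep_system R gT).
Variables (H1 H2 : {group gT}).
Variable Cst : R.
Hypothesis Cst0 : 0 < Cst.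
Hypothesis cG : (1 < #|gT|)%N.
Local Notation lnG := (ln (#|gT|%:R : R)).

Lemma Kdim_mul_ge (r : 'I_(nirr S)) : (0 < Kdim Cst r)%N /\ Cst * lnG ^+ 2 <= (mdim Cst r)%:R.
Proof.
have l0 : 0 < lnG by apply: lt_le_trans (ln_ge_half R cG); rewrite invr_gt0.
have d0 : 0 < (irdim r)%:R :> R by rewrite ltr0n irdim_gt0.
have y0 : 0 < Cst * lnG ^+ 2 / (irdim r)%:R by rewrite divr_gt0// mulr_gt0// exprn_gt0.
have yK : Cst * lnG ^+ 2 / (irdim r)%:R <= (Kdim Cst r)%:R.
  by rewrite /Kdim natr_absz; apply: le_trans (ceil_ge _) _; rewrite ler_int ler_norm.
split; first by rewrite -(ltr0n R); exact: lt_le_trans yK.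
by rewrite natrM -ler_pdivrMr.
Qed.

Section Realized.
Variable x : gidx S Cst -> R.

Lemma povm_distE : povm_dist x H1 H2 =
  \sum_(r < nirr S) \sum_(i < irdim r) \sum_(o : option 'I_(mdim Cst r))
    cabs (outcome_diff x H1 H2 i o).
Proof.
rewrite /povm_dist.
transitivity (\sum_(r < nirr S) \sum_(p : outc_fam Cst r)
   cabs (povm_prob x H1 (@Tagged _ r (@outc_fam R gT S Cst) p) -
         povm_prob x H2 (@Tagged _ r (@outc_fam R gT S Cst) p))).
  rewrite (sig_big_dep (fun=> true) (fun _ _ => true) (fun r (p : outc_fam Cst r) =>
   cabs (povm_prob x H1 (@Tagged _ r (@outc_fam R gT S Cst) p) -
         povm_prob x H2 (@Tagged _ r (@outc_fam R gT S Cst) p)))) /=.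
  by apply: eq_bigr => -[r p] _.
apply: eq_bigr => r _; rewrite pair_bigA /=; apply: eq_bigr => -[i o] _.
by rewrite /outcome_diff.
Qed.

(** [trace_le_outcomes], divided by the dimension and added over the rows [i]; no randomness
    enters. *)
Lemma wdist_le_povm_dist : wdist S H1 H2 <= povm_dist x H1 H2.
Proof.
rewrite povm_distE; apply: ler_sum => r _.
have d0 : 0 < (irdim r)%:R :> R by rewrite ltr0n irdim_gt0.
have -> : `|PH H1 r - PH H2 r| = \sum_(i < irdim r) `|PH H1 r - PH H2 r| / (irdim r)%:R.
  by rewrite sumr_const card_ord -[RHS]mulr_natr divfK// gt_eqF.
apply: ler_sum => i _; rewrite ler_pdivrMr// mulrC.
by apply: trace_le_outcomes; have [] := Kdim_mul_ge r.
Qed.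

Lemma frob_le_povm_dist (c : R) :
  (forall (r : 'I_(nirr S)) (i : 'I_(irdim r)),
     c * (frob (hdiff H1 H2 r) / #|gT|%:R) <= \sum_o cabs (outcome_diff x H1 H2 i o)) ->
  c * ((\sum_(r < nirr S) (irdim r)%:R * frob (hdiff H1 H2 r)) / #|gT|%:R) <= povm_dist x H1 H2.
Proof.
move=> h; rewrite povm_distE mulr_suml mulr_sumr; apply: ler_sum => r _.
have -> : c * ((irdim r)%:R * frob (hdiff H1 H2 r) / #|gT|%:R) =
    \sum_(i < irdim r) c * (frob (hdiff H1 H2 r) / #|gT|%:R).
  by rewrite sumr_const card_ord -[RHS]mulr_natr; ring.
by apply: ler_sum => i _; exact: h.
Qed.

(** The first part of [rdist] is at most the distance, and the Frobenius part at most [2 / c] times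
    the distance, where the 2 bounds [1 / ln #|gT|]. *)
Lemma rdist_le_povm_dist (c : R) : 0 < c ->
  (forall (r : 'I_(nirr S)) (i : 'I_(irdim r)),
     c * (frob (hdiff H1 H2 r) / #|gT|%:R) <= \sum_o cabs (outcome_diff x H1 H2 i o)) ->
  (1 + 2 / c)^-1 * rdist S H1 H2 <= povm_dist x H1 H2.
Proof.
move=> c0 h; have hf := frob_le_povm_dist h; have hw := wdist_le_povm_dist.
have l2 := ln_ge_half R cG.
have c1 : 0 < 1 + 2 / c by rewrite addr_gt0// divr_gt0.
rewrite mulrC ler_pdivrMr// mulrDr mulr1 /rdist; apply: lerD => //.
rewrite invfM -mulrA -[X in _^-1 * (_^-1 * X)]/(\sum_r _).
set F := \sum_(r < nirr S) (irdim r)%:R * frob (hdiff H1 H2 r) in hf.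
rewrite -[X in _^-1 * (_^-1 * X)]/F mulrCA [_ * F]mulrC.
have F0 : 0 <= F / #|gT|%:R.
  by rewrite divr_ge0// sumr_ge0// => r _; rewrite mulr_ge0// sqrtr_ge0.
apply: (@le_trans _ _ (2 * (F / #|gT|%:R))).
  apply: ler_wpM2r => //; rewrite -[leRHS]invrK lef_pV2 ?posrE//.
  exact: lt_le_trans l2.
have -> : povm_dist x H1 H2 * (2 / c) = 2 * (povm_dist x H1 H2 / c) by rewrite mulrCA.
by rewrite ler_pM2l// ler_pdivlMr// mulrC.
Qed.

End Realized.

Section BadEvent.
Variables (c : R).
Hypothesis c0 : 0 < c.
Hypothesis quadP : forall d (T : measurableType d) (P : probability T R) (K J : finType)
    (g : K * J -> T -> R) (Q : J -> J -> R), gaussian_family P g ->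
    (forall i j, Q i j = Q j i) -> \sum_i \sum_j Q i j ^+ 2 = 1 ->
    (P [set w | \sum_t `|bilf Q (fun j => g (t, j) w) (fun j => g (t, j) w)| < c * #|K|%:R]%R
      <= (expR (- (c * #|K|%:R)))%:E)%E.
Context d (T : measurableType d) (P : probability T R) (g : gidx S Cst -> T -> R).
Hypothesis gP : gaussian_family P g.

(** The union of three events: the quadratic forms are too small, or the matrix of real parts or
    that of imaginary parts is too large. [Num.min c 14] is a common rate, with [14] from
    [gaussian_matrix_tail]. *)
Lemma bad_event (r : 'I_(nirr S)) : exists B : set T, [/\ measurable B,
  (P B <= (3 * expR (- (Num.min c 14 * (mdim Cst r)%:R)))%:E)%E &
  forall w, ~ B w -> forall i : 'I_(irdim r),
    c / 1600 * (frob (hdiff H1 H2 r) / #|gT|%:R) <=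
      \sum_o cabs (outcome_diff (fun j => g j w) H1 H2 i o)].
Proof.
have [K0 _] := Kdim_mul_ge r.
set m := mdim Cst r.
(* Normalizing the form requires a nonzero Frobenius norm; if the norm is zero, there is nothing to
   bound. *)
have [F00|Fn0] := eqVneq (frob (hdiff H1 H2 r)) 0.
  exists set0; split=> //.
    by rewrite measure0 lee_fin mulr_ge0// expR_ge0.
  by move=> w _ i; rewrite F00 mul0r mulr0 sumr_ge0// => o _; exact: sqrtr_ge0.
have F0 : 0 < frob (hdiff H1 H2 r) by rewrite lt_neqAle eq_sym Fn0 sqrtr_ge0.
have s20 : 0 < Num.sqrt 2 :> R by rewrite sqrtr_gt0.
have m0 : (0 < m)%N by rewrite muln_gt0 K0 irdim_gt0.
have cI : #|{: 'I_(irdim r) * 'I_(Kdim Cst r)}| = m by rewrite card_prod !card_ord mulnC.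
(* [eX] selects all real or all imaginary parts, since [ell] is a norm on the full tensor product;
   [eQ] selects both parts at the ancilla coordinate [0], the only one that the measured state
   sees. *)
pose eX (s : bool) (p : 'I_m * ('I_(irdim r) * 'I_(Kdim Cst r))) : gidx S Cst :=
  @Tagged _ r (@gfam R gT S Cst) (p.1, p.2.1, p.2.2, s).
pose eQ (p : 'I_m * ('I_(irdim r) * bool)) : gidx S Cst :=
  @Tagged _ r (@gfam R gT S Cst) (p.1, p.2.1, Ordinal K0, p.2.2).
have eX_inj s : injective (eX s).
  by move=> [t [a k]] [t' [a' k']] /eqP; rewrite -tag_eqE /tag_eq /= eqxx tagged_asE
    => /eqP[-> -> ->].
have eQ_inj : injective eQ.
  by move=> [t [a k]] [t' [a' k']] /eqP; rewrite -tag_eqE /tag_eq /= eqxx tagged_asE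
    => /eqP[-> -> ->].
have [BX [mBX PBX hX]] := gaussian_matrix_tail m0 (card_ord m) cI
  (gaussian_family_sub (@eX_inj true) gP).
have [BY [mBY PBY hY]] := gaussian_matrix_tail m0 (card_ord m) cI
  (gaussian_family_sub (@eX_inj false) gP).
pose Q (u v : 'I_(irdim r) * bool) := qform H1 H2 u v / (Num.sqrt 2 * frob (hdiff H1 H2 r)).
have Qs u v : Q u v = Q v u by rewrite /Q qform_sym.
have Q1 : \sum_u \sum_v Q u v ^+ 2 = 1.
  transitivity ((\sum_(u : 'I_(irdim r) * bool) \sum_(v : 'I_(irdim r) * bool)
     qform H1 H2 u v ^+ 2) / (Num.sqrt 2 * frob (hdiff H1 H2 r)) ^+ 2).
    rewrite mulr_suml; apply: eq_bigr => u _; rewrite mulr_suml.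
    by apply: eq_bigr => v _; rewrite /Q expr_div_n.
  have s2 : Num.sqrt 2 ^+ 2 = 2 :> R by rewrite sqr_sqrtr.
  by rewrite sum_qform_sq exprMn s2 divff// mulf_neq0// expf_neq0.
have gQ := gaussian_family_sub eQ_inj gP.
have := quadP gQ Qs Q1; rewrite card_ord.
set BQ := [set w | _] => PBQ.
have mBQ : measurable BQ.
  have mf : measurable_fun setT (fun w => \sum_t
      `|bilf Q (fun j => g (eQ (t, j)) w) (fun j => g (eQ (t, j)) w)|).
    apply: measurable_bigsum => t; apply: measurableT_comp => //.
    by apply: measurable_bilf => u; exact: gP.1.
  have := mf measurableT _ (measurable_itv `]-oo, c * m%:R[).
  rewrite setTI; congr measurable; apply/seteqP; split => w /=; by rewrite in_itv.
exists (BQ `|` (BX `|` BY)); split.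
- by apply: measurableU => //; exact: measurableU.
- have mn0 : 0 <= m%:R :> R by [].
  have e1 : expR (- (c * m%:R)) <= expR (- (Num.min c 14 * m%:R)).
    by rewrite ler_expR lerN2 ler_wpM2r// ge_min lexx.
  have e2 : expR (- (14 * m%:R)) <= expR (- (Num.min c 14 * m%:R)).
    by rewrite ler_expR lerN2 ler_wpM2r// ge_min lexx orbT.
  apply: le_trans (measureU2 _ _ _) _ => //; first exact: measurableU.
  rewrite (_ : 3 * _ = expR (- (Num.min c 14 * m%:R)) + (expR (- (Num.min c 14 * m%:R)) +
     expR (- (Num.min c 14 * m%:R)))); last by ring.
  rewrite EFinD leeD//; first by apply: le_trans PBQ _; rewrite lee_fin.
  apply: le_trans (measureU2 _ _ _) _ => //.
  by rewrite EFinD leeD//; [apply: le_trans PBX _|apply: le_trans PBY _]; rewrite lee_fin.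
- move=> w /not_orP[nBQ /not_orP[nBX nBY]] i.
  apply: (@frob_le_outcomes _ _ _ _ _ _ _ _ K0 c c0 F0).
  + by rewrite leNgt; apply/negP; exact: nBQ.
  + exact: hX nBX.
  + exact: hY nBY.
Qed.

End BadEvent.

End Assembly.

(** In the trivial group the two subgroups coincide. This case is kept apart because the other
    estimates need [ln #|gT|] bounded away from 0. *)
Lemma rdist_trivial (R : realType) (gT : finGroupType) (S : irrep_system R gT)
    (H1 H2 : {group gT}) : (#|gT| <= 1)%N -> rdist S H1 H2 = 0.
Proof.
move=> c1.
have HT (H : {group gT}) : H :=: [set: gT]%SET.
  by apply/eqP; rewrite eqEcard finset.subsetT cardsT (leq_trans c1)// cardG_gt0.
have -> : H1 = H2 by apply/val_inj; rewrite /= (HT H1) (HT H2).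
rewrite /rdist /wdist big1 ?add0r => [|r _]; last by rewrite subrr normr0.
rewrite big1 ?mulr0// => r _; rewrite subrr /frob big1 ?sqrtr0 ?mulr0// => i _.
by rewrite big1// => j _; rewrite mxE /cnorm2 /= expr0n addr0.
Qed.

Theorem theorem2 (Rr : realType) :
  exists (Cst c : Rr), 0 < Cst /\ 0 < c /\
  forall (gT : finGroupType) (S : irrep_system Rr gT) (H1 H2 : {group gT})
    (d : measure_display) (T : measurableType d) (P : probability T Rr)
    (g : gidx S Cst -> T -> Rr),
    iid_std_gaussian P g ->
    exists A : set T, measurable A /\
      A `<=` [set w | c * rdist S H1 H2 <= povm_dist (fun i => g i w) H1 H2] /\
      ((1 - expR (- (ln (#|gT|%:R : Rr) ^+ 2)))%:E <= P A)%E.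
Proof.
have [c c0 quadP] := @quadratic_lower_tail Rr.
pose k : Rr := Num.min c 14.
have k0 : 0 < k by rewrite lt_min c0 ltr0n.
have c16 : 0 < c / 1600 by rewrite divr_gt0 ?ltr0n.
(* The factor 11 yields [k m >= 11 L^2] with [L = ln #|gT|]; the surplus [10 L^2] absorbs the number
   of irreps, at most [e^L], and the factor [3 <= e^2]. *)
exists (11 / k), (1 + 2 / (c / 1600))^-1; split; first by rewrite divr_gt0 ?ltr0n.
split; first by rewrite invr_gt0 addr_gt0 ?divr_gt0 ?ltr01 ?ltr0n.
move=> gT S H1 H2 d T P g /iid_gaussian_family gP.
have [G1|G1] := leqP #|gT| 1.
  exists setT; split=> //; split.
    move=> w _ /=; rewrite rdist_trivial// mulr0.
    by apply: sumr_ge0 => o _; exact: sqrtr_ge0.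
  by rewrite probability_setT lee_fin lerBlDr lerDl expR_ge0.
have C0 : 0 < 11 / k by rewrite divr_gt0 ?ltr0n.
have h r := cid (bad_event H1 H2 C0 G1 c0 quadP gP r).
pose B r := sval (h r).
have mB r : measurable (B r) by have [] := svalP (h r).
have PB r : (P (B r) <= (3 * expR (- (k * (mdim (11 / k) r)%:R)))%:E)%E.
  by have [_ + _] := svalP (h r); exact.
have BP r w : ~ B r w -> forall i : 'I_(irdim r),
    c / 1600 * (frob (hdiff H1 H2 r) / #|gT|%:R) <=
      \sum_o cabs (outcome_diff (fun j => g j w) H1 H2 i o).
  by have [_ _ +] := svalP (h r); exact.
pose U := \big[setU/set0]_(r <- index_enum 'I_(nirr S)) B r.
have mU : measurable U by apply: bigsetU_measurable.
exists (~` U); split; first exact: measurableC.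
split.
  move=> w nU /=; apply: rdist_le_povm_dist => // r i; apply: BP => Bw; apply: nU.
  by rewrite /U -bigcup_seq; exists r => //=; exact: mem_index_enum.
rewrite probability_setC// EFinB leeB//.
set L := ln _.
have L2 : 2^-1 <= L := ln_ge_half Rr G1.
apply: le_trans (measure_bigsetU_le P _ mB) _.
apply: (@le_trans _ _ (\sum_(r < nirr S) (3 * expR (- (11 * L ^+ 2)))%:E)%E).
  apply: lee_sum => r _; apply: le_trans (PB r) _.
  rewrite lee_fin ler_pM2l ?ltr0n// ler_expR lerN2.
  have [_ mge] := Kdim_mul_ge C0 G1 r.
  apply: le_trans (ler_wpM2l (ltW k0) mge); rewrite -/L.
  by rewrite !mulrA [k * 11]mulrC mulfK// gt_eqF.
rewrite sumEFin lee_fin sumr_const card_ord -[leLHS]mulr_natl.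
apply: (@le_trans _ _ (expR L * (expR 2 * expR (- (11 * L ^+ 2))))).
  apply: ler_pM => //; rewrite ?ler0n//.
  - rewrite lnK ?posrE ?ltr0n ?(ltn_trans _ G1)// ler_nat; exact: nirr_le_card.
  - by rewrite ler_wpM2r ?expR_ge0//; have := @expR_ge1Dx Rr 2; lra.
rewrite -!expRD ler_expR.
(* The product expands to [10 L^2 - L - 2], so [L >= 1/2] is exactly what makes
   [L + 2 - 11 L^2 <= - L^2]. *)
have : 0 <= (L - 2^-1) * (10 * L + 4) by rewrite mulr_ge0//; lra.
rewrite expr2; lra.
Qed.
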